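(* Let $X=\mathbb C_{\bar\alpha_1}\oplus\cdots\oplus\mathbb C_{\bar\alpha_n}$ be an object in the braided tensor category $\mathrm{Vect}_\Gamma$, and let $\mathfrak N$ be any Hopf algebra in $\mathrm{Vect}_\Gamma$ which is isomorphic to the Nichols algebra $\mathfrak B(X)$ as an object in $\mathrm{Vect}_\Gamma$. If $\mathfrak B(X)$ is sufficiently unrolled, then there is a Hopf algebra isomorphism $\mathfrak B(X)\to\mathfrak N$.
   Context: $\Gamma$ is an abelian group with a quadratic form $Q$ (for example $\Gamma=\mathbb C^n$ with an inner product and braiding $e^{\pi i(\lambda,\mu)}$), and $\mathrm{Vect}_\Gamma=\mathrm{Vect}_\Gamma^Q$ is the category of $\Gamma$-graded vector spaces with braiding and associator given by an abelian $3$-cocycle $(\sigma,\omega)$ with $\sigma(\lambda,\lambda)=Q(\lambda)$; $\mathbb C_\lambda$ is the one-dimensional object in degree $\lambda$. The Nichols algebra $\mathfrak B(X)$ is the $\mathbb N$-graded Hopf algebra in $\mathrm{Vect}_\Gamma$ which is the quotient of the tensor algebra $\mathfrak T(X)$ (a Hopf algebra with $\Delta(x)=1\otimes x+x\otimes1$ for $x\in X$) by its largest graded Hopf ideal in degrees $\ge2$, i.e. any graded Hopf quotient of $\mathfrak T(X)$ that is injective on $X$ maps onto $\mathfrak B(X)$. It is $\mathbb N^n$-graded, with the generator of $\mathbb C_{\bar\alpha_k}$ in degree $\alpha_k$, the formal basis of $\mathbb N^n$. Let $\mathrm{supp}(\mathfrak B(X))\subset\mathbb N^n$ be the set of degrees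 appearing and denote by a bar the additive map $\mathbb N^n\to\Gamma$ sending $\alpha_k$ to $\bar\alpha_k$. $\mathfrak B(X)$ is called sufficiently unrolled if $\bar\alpha+\bar\beta=\bar\gamma$ implies $\alpha+\beta=\gamma$ for all $\alpha,\beta,\gamma\in\mathrm{supp}(\mathfrak B(X))$. *)

(* Defs.v *)
From HB Require Import structures.
From mathcomp Require Import all_boot all_order all_algebra.
From mathcomp Require Import complex.
From mathcomp Require Import boolp classical_sets cardinality fsbigop reals.
From mathcomp Require Import finmap monalg.

Set Implicit Arguments.
Unset Strict Implicit.
Unset Printing Implicit Defensive.
Import GRing.Theory.
Local Open Scope ring_scope.
Local Open Scope quotient_scope.
Local Open Scope classical_set_scope.

Section TensorProduct.
Context (K : fieldType) (V W : lmodType K).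

Definition bilin (U : lmodType K) (b : V -> W -> U) : Prop :=
  (forall w, linear (b^~ w)) /\ (forall v, linear (b v)).

Definition evalsum (U : lmodType K) (b : V -> W -> U) (s : seq (V * W)) : U :=
  \sum_(p <- s) b p.1 p.2.

(* Formal sums of pairs are identified when all bilinear maps agree on them. *)
Definition tens_rel (s t : seq (V * W)) : bool :=
  `[< forall (U : lmodType K) (b : V -> W -> U),
        bilin b -> evalsum b s = evalsum b t >].

Lemma tens_rel_refl : reflexive tens_rel.
Proof. by move=> s; apply/asboolP. Qed.

Lemma tens_rel_sym : symmetric tens_rel.
Proof.
by move=> s t; apply/asboolP/asboolP => h U b hb; rewrite h.
Qed.

Lemma tens_rel_trans : transitive tens_rel.
Proof.
move=> s t u /asboolP h1 /asboolP h2; apply/asboolP => U b hb.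
by rewrite h1 // h2.
Qed.

Canonical tens_equiv :=
  EquivRel tens_rel tens_rel_refl tens_rel_sym tens_rel_trans.

Definition tens := {eq_quot tens_rel}.
HB.instance Definition _ := Choice.on tens.

Definition tclass (s : seq (V * W)) : tens := \pi_({eq_quot tens_rel}) s.
Definition trepr (t : tens) : seq (V * W) := repr (t : {eq_quot tens_rel}).

(* [tlift b] is the linear map induced by a bilinear map [b]; the formula is
   meaningful only for bilinear [b], see [tlift_linear] and [tlift_tprod]. *)
Definition tlift (U : lmodType K) (b : V -> W -> U) (t : tens) : U :=
  evalsum b (trepr t).

Lemma tlift_class (U : lmodType K) (b : V -> W -> U) s :
  bilin b -> tlift b (tclass s) = evalsum b s.
Proof.
move=> hb; rewrite /tlift /trepr /tclass.
have /asboolP h : tens_rel (repr (\pi_({eq_quot tens_rel}) s)) s.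
  by apply/(@eqmodP _ tens_equiv); rewrite reprK.
exact: h.
Qed.

Lemma tens_ext (t1 t2 : tens) :
  (forall (U : lmodType K) (b : V -> W -> U),
     bilin b -> tlift b t1 = tlift b t2) -> t1 = t2.
Proof.
move=> h; rewrite -[t1](@reprK _ {eq_quot tens_rel}).
rewrite -[t2](@reprK _ {eq_quot tens_rel}).
by apply/eqmodP/asboolP => U b hb; exact: h.
Qed.

Definition tadd (t1 t2 : tens) : tens := tclass (trepr t1 ++ trepr t2).
Definition tscale (c : K) (t : tens) : tens :=
  tclass [seq (c *: p.1, p.2) | p <- trepr t].
Definition topp (t : tens) : tens := tscale (-1) t.
Definition tzero : tens := tclass [::].

Lemma tlift_add (U : lmodType K) (b : V -> W -> U) t1 t2 : bilin b ->
  tlift b (tadd t1 t2) = tlift b t1 + tlift b t2.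
Proof. by move=> hb; rewrite tlift_class // /evalsum big_cat. Qed.

Lemma tlift_scale (U : lmodType K) (b : V -> W -> U) c t : bilin b ->
  tlift b (tscale c t) = c *: tlift b t.
Proof.
move=> hb; rewrite tlift_class // /tlift /evalsum big_map scaler_sumr.
apply: eq_bigr => p _ /=; have := hb.1 p.2 c p.1 0.
have /= := hb.1 p.2 (-1) 0 0; rewrite scaler0 addr0 scaleN1r addNr => ->.
by rewrite !addr0.
Qed.

Lemma tlift_zero (U : lmodType K) (b : V -> W -> U) : bilin b -> tlift b tzero = 0.
Proof. by move=> hb; rewrite tlift_class // /evalsum big_nil. Qed.

Lemma taddA : associative tadd.
Proof. by move=> x y z; apply: tens_ext => U b hb; rewrite !tlift_add ?addrA. Qed.

Lemma taddC : commutative tadd.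
Proof. by move=> x y; apply: tens_ext => U b hb; rewrite !tlift_add // addrC. Qed.

Lemma tadd0 : left_id tzero tadd.
Proof.
by move=> x; apply: tens_ext => U b hb; rewrite tlift_add // tlift_zero // add0r.
Qed.

Lemma taddN : left_inverse tzero topp tadd.
Proof.
move=> x; apply: tens_ext => U b hb.
by rewrite tlift_add // tlift_scale // tlift_zero // scaleN1r addNr.
Qed.

HB.instance Definition _ := GRing.isZmodule.Build tens taddA taddC tadd0 taddN.

Lemma tscaleA (a b : K) (t : tens) : tscale a (tscale b t) = tscale (a * b) t.
Proof. by apply: tens_ext => U f hf; rewrite !tlift_scale // scalerA. Qed.

Lemma tscale1 : left_id 1 tscale.
Proof. by move=> t; apply: tens_ext => U f hf; rewrite tlift_scale // scale1r. Qed.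

Lemma tscaleDr : right_distributive tscale +%R.
Proof.
move=> a s t; apply: tens_ext => U f hf.
by rewrite tlift_scale // !tlift_add // !tlift_scale // scalerDr.
Qed.

Lemma tscaleDl t : {morph tscale^~ t : a b / a + b}.
Proof.
move=> a b; apply: tens_ext => U f hf.
by rewrite tlift_add // !tlift_scale // scalerDl.
Qed.

HB.instance Definition _ := GRing.Zmodule_isLmodule.Build K tens
  tscaleA tscale1 tscaleDr tscaleDl.

Definition tprod (v : V) (w : W) : tens := tclass [:: (v, w)].

Lemma tlift_linear (U : lmodType K) (b : V -> W -> U) : bilin b -> linear (tlift b).
Proof. by move=> hb a s t; rewrite tlift_add // tlift_scale. Qed.

Lemma tlift_tprod (U : lmodType K) (b : V -> W -> U) v w :
  bilin b -> tlift b (tprod v w) = b v w.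
Proof. by move=> hb; rewrite tlift_class // /evalsum big_seq1. Qed.

Lemma tprod_bilin : bilin tprod.
Proof.
split=> [w a x y|v a x y]; apply: tens_ext => U b hb;
  rewrite tlift_add // tlift_scale // !tlift_tprod //.
  exact: hb.1.
exact: hb.2.
Qed.

Lemma tens_sum (t : tens) : t = \sum_(p <- trepr t) tprod p.1 p.2.
Proof.
apply: tens_ext => U b hb.
have -> : tlift b (\sum_(p <- trepr t) tprod p.1 p.2)
        = \sum_(p <- trepr t) tlift b (tprod p.1 p.2).
  by apply: (big_morph _ (fun x y => tlift_add x y hb)); rewrite tlift_zero.
by apply: eq_bigr => p _; rewrite tlift_tprod.
Qed.

Lemma tlift_unique (U : lmodType K) (f g : tens -> U) : linear f -> linear g ->
  (forall v w, f (tprod v w) = g (tprod v w)) -> f = g.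
Proof.
move=> hf hg fg; apply/funext => t.
have lin0 (h : tens -> U) : linear h -> h 0 = 0.
  move=> hh; have := hh (-1) 0 0.
  by rewrite scaler0 addr0 scaleN1r addNr.
have sumE (h : tens -> U) : linear h ->
    h t = \sum_(p <- trepr t) h (tprod p.1 p.2).
  move=> hh; rewrite {1}[t]tens_sum; apply: (big_morph h); last exact: lin0.
  by move=> x y; have := hh 1 x y; rewrite !scale1r.
by rewrite !sumE //; apply: eq_bigr => p _; exact: fg.
Qed.

End TensorProduct.

Arguments bilin {K V W U} b.
Arguments tlift {K V W U} b t.
Arguments tprod {K V W} v w.
Notation "v '⊗' w" := (tprod v w) (at level 39, left associativity).

Section GradedSpaces.
Context (K : fieldType) (Γ : zmodType).

(* A Γ-graded vector space, the grading being given by the projections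
   [gpr g] onto the homogeneous components. *)
Record gvect := GVect {
  gspace :> lmodType K;
  gpr : Γ -> gspace -> gspace;
  gpr_linear : forall g, linear (gpr g);
  gpr_gpr : forall g h v, gpr g (gpr h v) = if g == h then gpr h v else 0;
  gpr_sum : forall v, exists2 s, uniq s & v = \sum_(g <- s) gpr g v
}.

Definition homog (V : gvect) (g : Γ) (v : V) : Prop := gpr g v = v.

Definition gmorph (V W : gvect) (f : V -> W) : Prop :=
  linear f /\ forall g v, f (gpr g v) = gpr g (f v).

Definition giso (V W : gvect) (f : V -> W) : Prop := gmorph f /\ bijective f.

Definition gisomorphic (V W : gvect) : Prop := exists f : V -> W, giso f.

Lemma lin0 (V W : lmodType K) (f : V -> W) : linear f -> f 0 = 0.
Proof. by move=> h; have := h (-1) 0 0; rewrite scaler0 addr0 scaleN1r addNr. Qed.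

Lemma linD (V W : lmodType K) (f : V -> W) x y : linear f -> f (x + y) = f x + f y.
Proof. by move=> h; have := h 1 x y; rewrite !scale1r. Qed.

Lemma linZ (V W : lmodType K) (f : V -> W) a x : linear f -> f (a *: x) = a *: f x.
Proof. by move=> h; have := h a x 0; rewrite !addr0 lin0 // addr0. Qed.

Lemma lin_sum (V W : lmodType K) (f : V -> W) I (r : seq I) (P : pred I) F :
  linear f -> f (\sum_(i <- r | P i) F i) = \sum_(i <- r | P i) f (F i).
Proof.
move=> hf; apply: (big_morph f); last exact: lin0.
by move=> x y; exact: linD.
Qed.

Lemma tprod0l (V W : lmodType K) (w : W) : (0 : V) ⊗ w = 0.
Proof. exact: (lin0 ((tprod_bilin V W).1 w)). Qed.

Lemma tprod0r (V W : lmodType K) (v : V) : v ⊗ (0 : W) = 0.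
Proof. exact: (lin0 ((tprod_bilin V W).2 v)). Qed.

Lemma gpr_supp (V : gvect) (v : V) (s : seq Γ) g :
  v = \sum_(h <- s) gpr h v -> g \notin s -> gpr g v = 0.
Proof.
move=> -> gs; rewrite lin_sum; last exact: gpr_linear.
rewrite big_seq big1 // => h hs; rewrite gpr_gpr.
by case: eqP => // gh; rewrite gh hs in gs.
Qed.

Lemma fsum_seq (W : nmodType) (s : seq Γ) (F : Γ -> W) : uniq s ->
  (forall g, g \notin s -> F g = 0) ->
  \sum_(g \in [set: Γ]) F g = \sum_(g <- s) F g.
Proof.
move=> us h; rewrite (fsbigE s) //; last by move=> g _; exact: h.
by apply: eq_bigl => g; rewrite in_setT.
Qed.

Lemma gpr_common (V : gvect) (v w : V) : exists2 s : seq Γ, uniq s &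
  forall g, g \notin s -> gpr g v = 0 /\ gpr g w = 0.
Proof.
have [s us hs] := gpr_sum v; have [t ut ht] := gpr_sum w.
exists (undup (s ++ t)); first exact: undup_uniq.
move=> g; rewrite mem_undup mem_cat negb_or => /andP[gs gt].
by split; [exact: gpr_supp hs gs | exact: gpr_supp ht gt].
Qed.

Lemma fsum_linear (V : gvect) (W : lmodType K) (F : Γ -> V -> W) :
  (forall g, linear (F g)) -> (forall g v, gpr g v = 0 -> F g v = 0) ->
  linear (fun v => \sum_(g \in [set: Γ]) F g v).
Proof.
move=> hF h0 a x y; have [s us hs] := gpr_common x y.
rewrite !(fsum_seq us); first last.
- by move=> g /hs[gx gy]; rewrite hF !h0 // scaler0 addr0.
- by move=> g /hs[gx gy]; rewrite h0.
- by move=> g /hs[gx gy]; rewrite h0.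
by rewrite scaler_sumr -big_split /=; apply: eq_bigr => g _; rewrite hF.
Qed.

Section TensorGrading.
Context (V W : gvect).

Definition tgpr_bil (g : Γ) (v : V) (w : W) : tens V W :=
  \sum_(h \in [set: Γ]) gpr h v ⊗ gpr (g - h) w.

Definition tgpr (g : Γ) : tens V W -> tens V W := tlift (tgpr_bil g).

Lemma tgpr_bil_bilin g : bilin (tgpr_bil g).
Proof.
have [hl hr] := tprod_bilin V W.
split=> [w|v].
  apply: fsum_linear => [h a x y|h v e].
    by rewrite gpr_linear hl.
  by rewrite e tprod0l.
move=> a x y; have [s us hs] := gpr_sum v.
have z h w : h \notin s -> gpr h v ⊗ gpr (g - h) w = 0.
  by move=> hn; rewrite (gpr_supp hs hn) tprod0l.
rewrite /tgpr_bil !(fsum_seq us) //; try by move=> *; rewrite z.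
rewrite scaler_sumr -big_split /=; apply: eq_bigr => h _.
by rewrite gpr_linear hr.
Qed.

Lemma tgpr_linear g : linear (tgpr g).
Proof. exact: tlift_linear (tgpr_bil_bilin g). Qed.

Lemma tgpr_homog g h k v w : homog h v -> homog k w ->
  tgpr g (v ⊗ w) = if g == h + k then v ⊗ w else 0.
Proof.
move=> hv hw; rewrite /tgpr tlift_tprod; last exact: tgpr_bil_bilin.
have [hl hr] := tprod_bilin V W.
rewrite /tgpr_bil (@fsum_seq _ [:: h]) // => [|l]; last first.
  by rewrite inE -hv gpr_gpr => /negbTE ->; rewrite tprod0l.
rewrite big_seq1 hv -hw gpr_gpr subr_eq addrC.
by case: eqP => // _; rewrite ?hw //; rewrite tprod0r.
Qed.

Lemma tens_homog_sum (t : tens V W) : exists s : seq (V * W),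
  t = \sum_(p <- s) p.1 ⊗ p.2 /\
  forall p, p \in s -> exists h k, homog h p.1 /\ homog k p.2.
Proof.
have [hl hr] := tprod_bilin V W.
rewrite [t]tens_sum; elim: (trepr t) => [|[v w] r [s [es hs]]].
  by exists [::]; rewrite !big_nil.
have [sv uv ev] := gpr_sum v; have [sw uw ew] := gpr_sum w.
exists ([seq (gpr h v, gpr k w) | h <- sv, k <- sw] ++ s); split.
  rewrite big_cons big_cat -es; congr (_ + _) => /=.
  rewrite big_allpairs_dep /= {1}ev (@lin_sum _ _ (tprod^~ w)) //.
  apply: eq_bigr => h _ /=; rewrite {1}ew (@lin_sum _ _ (tprod _)) //.
move=> p; rewrite mem_cat => /orP[|/hs //].
case/allpairsP => [[h k] [_ _ ->]] /=; exists h, k.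
by split; rewrite /homog gpr_gpr eqxx.
Qed.

Lemma tgpr_tgpr g h t : tgpr g (tgpr h t) = if g == h then tgpr h t else 0.
Proof.
have [s [-> hs]] := tens_homog_sum t.
have lg := tgpr_linear g; have lh := tgpr_linear h.
rewrite !(lin_sum _ _ _ lh) (lin_sum _ _ _ lg).
transitivity (\sum_(p <- s) if g == h then tgpr h (p.1 ⊗ p.2) else 0); last first.
  by case: eqP => // _; rewrite big1.
apply: eq_big_seq => p /hs[a [b [ha hb]]].
rewrite (tgpr_homog _ ha hb); case: (h =P a + b) => [->|_].
  by rewrite (tgpr_homog _ ha hb).
by rewrite lin0 //; case: ifP.
Qed.

Lemma tgpr_sum t : exists2 s, uniq s & t = \sum_(g <- s) tgpr g t.
Proof.
have [r [-> hr]] := tens_homog_sum t.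
suff [s us hs] : exists2 s : seq Γ, uniq s &
    forall p, p \in r -> p.1 ⊗ p.2 = \sum_(g <- s) tgpr g (p.1 ⊗ p.2).
  exists s => //; rewrite {1}(eq_big_seq _ hs) exchange_big.
  apply: eq_bigr => g _; rewrite lin_sum //; exact: tgpr_linear.
elim: r hr => [|p r IH] hr; first by exists [::].
have [|s us hs] := IH; first by move=> q qr; apply: hr; rewrite inE qr orbT.
have [|a [b [ha hb]]] := hr p; first by rewrite inE eqxx.
exists (undup (a + b :: s)); first exact: undup_uniq.
have key q c d : homog c q.1 -> homog d q.2 -> c + d \in undup (a + b :: s) ->
    q.1 ⊗ q.2 = \sum_(g <- undup (a + b :: s)) tgpr g (q.1 ⊗ q.2).
  move=> hc hd cd; rewrite (bigD1_seq (c + d)) ?undup_uniq //=.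
  rewrite (tgpr_homog _ hc hd) eqxx big1 ?addr0 // => i ic.
  by rewrite (tgpr_homog _ hc hd) (negbTE ic).
move=> q; rewrite inE => /predU1P[->|qr].
  by apply: (key _ a b) => //; rewrite mem_undup inE eqxx.
have [|c [d [hc hd]]] := hr q; first by rewrite inE qr orbT.
case: (c + d \in undup (a + b :: s)) / boolP => cd; first exact: key cd.
have q0 : q.1 ⊗ q.2 = 0.
  rewrite (hs q qr) big_seq big1 // => g gs; rewrite (tgpr_homog _ hc hd).
  case: eqP => // gcd; move: cd.
  by rewrite mem_undup inE -gcd gs orbT.
by rewrite q0 big1 // => g _; rewrite lin0 //; exact: tgpr_linear.
Qed.

Definition gtens : gvect := GVect tgpr_linear tgpr_tgpr tgpr_sum.

End TensorGrading.
End GradedSpaces.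

Arguments gtens {K Γ} V W.
Arguments homog {K Γ V} g v.

(* The associator (U ⊗ V) ⊗ W -> U ⊗ (V ⊗ W) is [omega] and the braiding
   V ⊗ W -> W ⊗ V is [sigma] on homogeneous elements.  The cocycle is
   normalised, so that unitors are trivial; the other normalisations of
   [omega] and those of [sigma] follow from [omega_unit]. *)
Record abelian3cocycle (K : fieldType) (Γ : zmodType) := Abelian3Cocycle {
  omega : Γ -> Γ -> Γ -> K;
  sigma : Γ -> Γ -> K;
  omega_neq0 : forall x y z, omega x y z != 0;
  sigma_neq0 : forall x y, sigma x y != 0;
  omega_unit : forall x y, omega x 0 y = 1;
  pentagon : forall x y z t,
    omega y z t * omega x (y + z) t * omega x y z =
    omega x y (z + t) * omega (x + y) z t;
  hexagon1 : forall x y z,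
    omega y z x * sigma x (y + z) * omega x y z =
    sigma x z * omega y x z * sigma x y;
  hexagon2 : forall x y z,
    (omega z x y)^-1 * sigma (x + y) z * (omega x y z)^-1 =
    sigma x z * (omega x z y)^-1 * sigma y z
}.

Definition quadratic_form (K : fieldType) (Γ : zmodType) (Q : Γ -> K) : Prop :=
  let b x y := Q (x + y) / (Q x * Q y) in
  [/\ forall x, Q x != 0,
      forall x, Q (- x) = Q x,
      forall x y z, b (x + y) z = b x z * b y z &
      forall x y z, b x (y + z) = b x y * b x z].

Section BraidedStructure.
Context (K : fieldType) (Γ : zmodType) (c : abelian3cocycle K Γ).
Implicit Types U V W : gvect K Γ.

Definition tmap (V W V' W' : lmodType K) (f : V -> V') (g : W -> W') :
  tens V W -> tens V' W' := tlift (fun v w => f v ⊗ g w).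

Definition assoc_bil U V W (w : W) (u : U) (v : V) : tens U (gtens V W) :=
  \sum_(x \in [set: Γ]) \sum_(y \in [set: Γ]) \sum_(z \in [set: Γ])
    omega c x y z *: (gpr x u ⊗ (gpr y v ⊗ gpr z w)).

Definition assoc U V W : gtens (gtens U V) W -> gtens U (gtens V W) :=
  tlift (fun t w => tlift (assoc_bil w) t).

Definition associnv_bil U V W (u : U) (v : V) (w : W) : tens (gtens U V) W :=
  \sum_(x \in [set: Γ]) \sum_(y \in [set: Γ]) \sum_(z \in [set: Γ])
    (omega c x y z)^-1 *: ((gpr x u ⊗ gpr y v) ⊗ gpr z w).

Definition associnv U V W : gtens U (gtens V W) -> gtens (gtens U V) W :=
  tlift (fun u t => tlift (associnv_bil u) t).

Definition braid_bil V W (v : V) (w : W) : tens W V :=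
  \sum_(x \in [set: Γ]) \sum_(y \in [set: Γ])
    sigma c x y *: (gpr y w ⊗ gpr x v).

Definition braid V W : gtens V W -> gtens W V := tlift (@braid_bil V W).

Lemma fsum_linear_fin (V W : lmodType K) (F : Γ -> V -> W) (s : seq Γ) :
  uniq s -> (forall g, linear (F g)) ->
  (forall g v, g \notin s -> F g v = 0) ->
  linear (fun v => \sum_(g \in [set: Γ]) F g v).
Proof.
move=> us hF h0 k x y; rewrite !(fsum_seq us); try by move=> g /h0 ->.
by rewrite scaler_sumr -big_split /=; apply: eq_bigr => g _; rewrite hF.
Qed.

Section TripleSum.
Context (U V W : gvect K Γ) (T : lmodType K) (f : U -> V -> W -> T).
Context (k : Γ -> Γ -> Γ -> K).
Context (f1 : forall v w, linear (fun u => f u v w)).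
Context (f2 : forall u w, linear (fun v => f u v w)).
Context (f3 : forall u v, linear (fun w => f u v w)).

Let f10 v w : f 0 v w = 0. Proof. exact: lin0 (f1 v w). Qed.
Let f20 u w : f u 0 w = 0. Proof. exact: lin0 (f2 u w). Qed.
Let f30 u v : f u v 0 = 0. Proof. exact: lin0 (f3 u v). Qed.

Let F u v w := \sum_(x \in [set: Γ]) \sum_(y \in [set: Γ])
  \sum_(z \in [set: Γ]) k x y z *: f (gpr x u) (gpr y v) (gpr z w).

Let sum0 (G : Γ -> T) : (forall g, G g = 0) -> \sum_(g \in [set: Γ]) G g = 0.
Proof. by move=> h; apply: fsbig1 => g _. Qed.

Let scl (X : lmodType K) (g : X -> T) b : linear g -> linear (fun x => b *: g x).
Proof. by move=> hg a x y; rewrite hg scalerDr !scalerA mulrC. Qed.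

Let comp_gpr (X : gvect K Γ) (g : X -> T) x :
  linear g -> linear (fun u => g (gpr x u)).
Proof. by move=> hg a u v; rewrite gpr_linear hg. Qed.

Lemma triple_linear1 v w : linear (fun u => F u v w).
Proof.
have [sv uv hv] := gpr_sum v; have [sw uw hw] := gpr_sum w.
apply: fsum_linear => [x|x u e]; last first.
  by do 2![apply: sum0 => ?]; rewrite e f10 scaler0.
apply: (fsum_linear_fin uv) => [y|y u hy]; last first.
  by apply: sum0 => z; rewrite (gpr_supp hv hy) f20 scaler0.
apply: (fsum_linear_fin uw) => [z|z u hz]; last first.
  by rewrite (gpr_supp hw hz) f30 scaler0.
by apply: scl; apply: (comp_gpr (g := fun u => f u (gpr y v) (gpr z w))).
Qed.

Lemma triple_linear2 u w : linear (fun v => F u v w).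
Proof.
have [su uu hu] := gpr_sum u; have [sw uw hw] := gpr_sum w.
apply: (fsum_linear_fin uu) => [x|x v hx]; last first.
  by do 2![apply: sum0 => ?]; rewrite (gpr_supp hu hx) f10 scaler0.
apply: fsum_linear => [y|y v e]; last first.
  by apply: sum0 => z; rewrite e f20 scaler0.
apply: (fsum_linear_fin uw) => [z|z v hz]; last first.
  by rewrite (gpr_supp hw hz) f30 scaler0.
by apply: scl; apply: (comp_gpr (g := fun v => f (gpr x u) v (gpr z w))).
Qed.

Lemma triple_linear3 u v : linear (fun w => F u v w).
Proof.
have [su uu hu] := gpr_sum u; have [sv uv hv] := gpr_sum v.
apply: (fsum_linear_fin uu) => [x|x w hx]; last first.
  by do 2![apply: sum0 => ?]; rewrite (gpr_supp hu hx) f10 scaler0.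
apply: (fsum_linear_fin uv) => [y|y w hy]; last first.
  by apply: sum0 => z; rewrite (gpr_supp hv hy) f20 scaler0.
apply: fsum_linear => [z|z w e]; last by rewrite e f30 scaler0.
by apply: scl; apply: (comp_gpr (g := fun w => f (gpr x u) (gpr y v) w)).
Qed.

Lemma triple_homog x y z u v w : homog x u -> homog y v -> homog z w ->
  F u v w = k x y z *: f u v w.
Proof.
have supp (X : gvect K Γ) (g h : Γ) (r : X) :
    homog h r -> g \notin [:: h] -> gpr g r = 0.
  by move=> hr; rewrite inE -hr gpr_gpr => /negbTE ->.
move=> hu hv hw; rewrite /F (@fsum_seq _ _ [:: x]) // => [|g gx]; last first.
  by do 2![apply: sum0 => ?]; rewrite (supp _ _ _ _ hu gx) f10 scaler0.
rewrite big_seq1 (@fsum_seq _ _ [:: y]) // => [|g gy]; last first.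
  by apply: sum0 => ?; rewrite (supp _ _ _ _ hv gy) f20 scaler0.
rewrite big_seq1 (@fsum_seq _ _ [:: z]) // => [|g gz]; last first.
  by rewrite (supp _ _ _ _ hw gz) f30 scaler0.
by rewrite big_seq1 hu hv hw.
Qed.

End TripleSum.

Let pl (V W : lmodType K) (w : W) : linear (fun v : V => v ⊗ w).
Proof. exact: (tprod_bilin V W).1. Qed.

Let pr (V W : lmodType K) (v : V) : linear (fun w : W => v ⊗ w).
Proof. exact: (tprod_bilin V W).2. Qed.

Lemma assoc_bil_bilin U V W (w : W) : bilin (@assoc_bil U V W w).
Proof.
split=> [v|u].
- apply: (triple_linear1 (f := fun u v w => u ⊗ (v ⊗ w) : tens U (gtens V W)))
    => [v' w'|u' w'|u' v'] k s t; by rewrite ?pl ?pr.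
- apply: (triple_linear2 (f := fun u v w => u ⊗ (v ⊗ w) : tens U (gtens V W)))
    => [v' w'|u' w'|u' v'] k s t; by rewrite ?pl ?pr.
Qed.

Lemma assoc_bilin U V W :
  bilin (fun (t : gtens U V) (w : W) => tlift (@assoc_bil U V W w) t).
Proof.
split=> [w|t]; first by move=> k s r; exact: (tlift_linear (@assoc_bil_bilin U V W w) k s r).
move=> k s r; rewrite /tlift /evalsum scaler_sumr -big_split /=.
apply: eq_bigr => p _.
apply: (triple_linear3 (f := fun u v w => u ⊗ (v ⊗ w) : tens U (gtens V W)))
    => [v' w'|u' w'|u' v'] k' s' t'; by rewrite ?pl ?pr.
Qed.

Lemma assoc_homog U V W x y z (u : U) (v : V) (w : W) :
  homog x u -> homog y v -> homog z w ->
  assoc ((u ⊗ v : gtens U V) ⊗ w) = omega c x y z *: (u ⊗ (v ⊗ w)).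
Proof.
move=> hu hv hw; rewrite /assoc tlift_tprod; last exact: assoc_bilin.
rewrite tlift_tprod; last exact: assoc_bil_bilin.
apply: (triple_homog (f := fun u v w => u ⊗ (v ⊗ w) : tens U (gtens V W)))
    => // [v' w'|u' w'|u' v'] k' s' t'; by rewrite ?pl ?pr.
Qed.

Lemma associnv_bil_bilin U V W (u : U) : bilin (@associnv_bil U V W u).
Proof.
split=> [w|v].
- apply: (triple_linear2 (f := fun u v w => u ⊗ v ⊗ w : tens (gtens U V) W))
    => [v' w'|u' w'|u' v'] k s t; by rewrite ?pl ?pr ?pl.
- apply: (triple_linear3 (f := fun u v w => u ⊗ v ⊗ w : tens (gtens U V) W))
    => [v' w'|u' w'|u' v'] k s t; by rewrite ?pl ?pr ?pl.
Qed.

Lemma associnv_bilin U V W :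
  bilin (fun (u : U) (t : gtens V W) => tlift (@associnv_bil U V W u) t).
Proof.
split=> [t|u]; last by move=> k s r; exact: (tlift_linear (@associnv_bil_bilin U V W u) k s r).
move=> k s r; rewrite /tlift /evalsum scaler_sumr -big_split /=.
apply: eq_bigr => p _.
apply: (triple_linear1 (f := fun u v w => u ⊗ v ⊗ w : tens (gtens U V) W))
    => [v' w'|u' w'|u' v'] k' s' t'; by rewrite ?pl ?pr ?pl.
Qed.

Lemma associnv_homog U V W x y z (u : U) (v : V) (w : W) :
  homog x u -> homog y v -> homog z w ->
  associnv (u ⊗ (v ⊗ w : gtens V W)) = (omega c x y z)^-1 *: ((u ⊗ v) ⊗ w).
Proof.
move=> hu hv hw; rewrite /associnv tlift_tprod; last exact: associnv_bilin.
rewrite tlift_tprod; last exact: associnv_bil_bilin.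
apply: (@triple_homog U V W (tens (gtens U V) W) (fun u v w => u ⊗ v ⊗ w)
  (fun x y z => (omega c x y z)^-1))
    => // [v' w'|u' w'|u' v'] k' s' t'; by rewrite ?pl ?pr ?pl.
Qed.

Lemma braid_bil_bilin V W : bilin (@braid_bil V W).
Proof.
split=> [w|v].
  have [s us hs] := gpr_sum w.
  apply: fsum_linear => [x|x v e].
    apply: (fsum_linear_fin us) => [y|y v hy] /=.
      move=> k p q; rewrite gpr_linear pr scalerDr !scalerA.
      by rewrite (mulrC _ k).
    by rewrite (gpr_supp hs hy) tprod0l scaler0.
  by apply: fsbig1 => y _; rewrite e tprod0r scaler0.
have [s us hs] := gpr_sum v.
apply: (fsum_linear_fin us) => [x|x w hx].
  apply: fsum_linear => [y|y w e].
    move=> k p q; rewrite gpr_linear pl scalerDr !scalerA.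
    by rewrite (mulrC _ k).
  by rewrite e tprod0l scaler0.
by apply: fsbig1 => y _; rewrite (gpr_supp hs hx) tprod0r scaler0.
Qed.

Lemma braid_homog V W x y (v : V) (w : W) : homog x v -> homog y w ->
  braid (v ⊗ w) = sigma c x y *: (w ⊗ v).
Proof.
move=> hv hw; rewrite /braid tlift_tprod; last exact: braid_bil_bilin.
have supp (X : gvect K Γ) (g h : Γ) (r : X) :
    homog h r -> g \notin [:: h] -> gpr g r = 0.
  by move=> hr; rewrite inE -hr gpr_gpr => /negbTE ->.
rewrite /braid_bil (@fsum_seq _ _ [:: x]) // => [|g gx]; last first.
  by apply: fsbig1 => ? _; rewrite (supp _ _ _ _ hv gx) tprod0r scaler0.
rewrite big_seq1 (@fsum_seq _ _ [:: y]) // => [|g gy]; last first.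
  by rewrite (supp _ _ _ _ hw gy) tprod0l scaler0.
by rewrite big_seq1 hv hw.
Qed.

(* (A ⊗ B) ⊗ (C ⊗ D) -> (A ⊗ C) ⊗ (B ⊗ D) *)
Definition interchange (A B C D : gvect K Γ)
    (t : gtens (gtens A B) (gtens C D)) : gtens (gtens A C) (gtens B D) :=
  let t1 : gtens A (gtens B (gtens C D)) := assoc t in
  let t2 : gtens A (gtens (gtens B C) D) := tmap id (@associnv B C D) t1 in
  let t3 : gtens A (gtens (gtens C B) D) :=
    tmap id (tmap (@braid B C) id) t2 in
  let t4 : gtens A (gtens C (gtens B D)) := tmap id (@assoc C B D) t3 in
  associnv t4.

(* The line C_λ. *)
Section Line.
Context (l : Γ).
Definition line_gpr (g : Γ) (v : K^o) : K^o := if g == l then v else 0.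

Lemma line_gpr_linear g : linear (line_gpr g).
Proof.
by move=> a x y; rewrite /line_gpr; case: (g == l) => //; rewrite scaler0 addr0.
Qed.

Lemma line_gpr_gpr g h v :
  line_gpr g (line_gpr h v) = if g == h then line_gpr h v else 0.
Proof.
rewrite /line_gpr; case: (g =P h) => [->|gh]; first by case: (h == l).
case: (g =P l) => // gl; case: (h =P l) => // hl.
by case: gh; rewrite gl hl.
Qed.

Lemma line_gpr_sum v : exists2 s, uniq s & v = \sum_(g <- s) line_gpr g v.
Proof. by exists [:: l] => //; rewrite big_seq1 /line_gpr eqxx. Qed.

Definition line : gvect K Γ := GVect line_gpr_linear line_gpr_gpr line_gpr_sum.
End Line.

(* The product of the braided tensor square of an algebra. *)
Definition mul2 (A : gvect K Γ) (m : gtens A A -> A) (s t : gtens A A) :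
  gtens A A := tmap m m (interchange (s ⊗ t)).

Record hopf_ops (A : gvect K Γ) := HopfOps {
  hmul : gtens A A -> A;
  hone : A;
  hcomul : A -> gtens A A;
  hcounit : A -> line 0;
  hantipode : A -> A
}.

Record hopf_axioms (A : gvect K Γ) (H : hopf_ops A) : Prop := HopfAxioms {
  hmul_gmorph : gmorph (hmul H);
  hone_homog : homog 0 (hone H);
  hcomul_gmorph : gmorph (hcomul H);
  hcounit_gmorph : gmorph (hcounit H);
  hantipode_gmorph : gmorph (hantipode H);
  hmulA : forall t : gtens (gtens A A) A,
    hmul H (tmap (hmul H) id t) = hmul H (tmap id (hmul H) (assoc t));
  hmul1l : forall x, hmul H (hone H ⊗ x) = x;
  hmul1r : forall x, hmul H (x ⊗ hone H) = x;
  hcomulA : forall x,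
    assoc (tmap (hcomul H) id (hcomul H x) : gtens (gtens A A) A) =
    tmap id (hcomul H) (hcomul H x);
  hcounitl : forall x,
    tlift (fun y z => (hcounit H y : K) *: z) (hcomul H x) = x;
  hcounitr : forall x,
    tlift (fun y z => (hcounit H z : K) *: y) (hcomul H x) = x;
  hcomulM : forall x y,
    hcomul H (hmul H (x ⊗ y)) = mul2 (hmul H) (hcomul H x) (hcomul H y);
  hcomul1 : hcomul H (hone H) = hone H ⊗ hone H;
  hcounitM : forall x y,
    hcounit H (hmul H (x ⊗ y)) = (hcounit H x : K) * hcounit H y;
  hcounit1 : hcounit H (hone H) = (1 : K);
  hantipodel : forall x,
    hmul H (tmap (hantipode H) id (hcomul H x)) = (hcounit H x : K) *: hone H;
  hantipoder : forall x,
    hmul H (tmap id (hantipode H) (hcomul H x)) = (hcounit H x : K) *: hone H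
}.

Record hopfAlg := HopfAlg {
  hspace :> gvect K Γ;
  hops : hopf_ops hspace;
  hopfP : hopf_axioms hops
}.

Record hopf_morph (A B : gvect K Γ) (HA : hopf_ops A) (HB : hopf_ops B)
    (f : A -> B) : Prop := HopfMorph {
  hm_gmorph : gmorph f;
  hm_mul : forall t, f (hmul HA t) = hmul HB (tmap f f t);
  hm_one : f (hone HA) = hone HB;
  hm_comul : forall x, hcomul HB (f x) = tmap f f (hcomul HA x);
  hm_counit : forall x, hcounit HB (f x) = hcounit HA x;
  hm_antipode : forall x, hantipode HB (f x) = f (hantipode HA x)
}.

Definition hopf_iso (A B : hopfAlg) (f : A -> B) : Prop :=
  hopf_morph (hops A) (hops B) f /\ bijective f.

Record hopf_ideal (A : gvect K Γ) (H : hopf_ops A) (I : set A) : Prop := HopfIdeal {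
  hi_zero : I 0;
  hi_linear : forall a x y, I x -> I y -> I (a *: x + y);
  hi_graded : forall g x, I x -> I (gpr g x);
  hi_mull : forall x y, I y -> I (hmul H (x ⊗ y));
  hi_mulr : forall x y, I x -> I (hmul H (x ⊗ y));
  (* Δ(I) is contained in I ⊗ A + A ⊗ I *)
  hi_comul : forall x, I x -> exists s : seq (A * A),
    hcomul H x = \sum_(p <- s) p.1 ⊗ p.2 /\
    (forall p, p \in s -> I p.1 \/ I p.2);
  hi_counit : forall x, I x -> hcounit H x = 0;
  hi_antipode : forall x, I x -> I (hantipode H x)
}.

Section TensorAlgebra.
Context (n : nat) (a : 'I_n -> Γ).

(* For X the direct sum of the lines of degrees a_0, ..., a_(n-1), the word
   i_1 i_2 ... i_k stands for the basis element
   x_(i_1) ⊗ (x_(i_2) ⊗ (... ⊗ x_(i_k))) of the k-th tensor power of X. *)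
Definition word := seq 'I_n.
Definition wdeg (w : word) : Γ := \sum_(i <- w) a i.

Definition lext (V : lmodType K) (f : word -> V) (t : {malg K[word]}) : V :=
  \sum_(w <- msupp t) t@_w *: f w.

Definition talg_gpr (g : Γ) (t : {malg K[word]}) : {malg K[word]} :=
  lext (fun w => if g == wdeg w then << w >> else 0) t.

Lemma lext_linear (V : lmodType K) (f : word -> V) : linear (lext f).
Proof.
move=> k s t.
have E (D : {fset word}) u : (msupp u `<=` D)%fset ->
    lext f u = \sum_(w <- D) u@_w *: f w.
  move=> uD; rewrite /lext (big_fset_incl _ uD) //= => w _ wu.
  by rewrite (mcoeff_outdom wu) scale0r.
pose D := (msupp s `|` msupp t)%fset.
rewrite !(E D) ?fsubsetUl ?fsubsetUr //; last first.
  apply: fsubset_trans (msuppD_le _ _) _.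
  by apply: fsetUSS (fsubset_refl _); exact: msuppZ_le.
rewrite scaler_sumr -big_split /=; apply: eq_bigr => w _.
by rewrite mcoeffD mcoeffZ scalerDl scalerA.
Qed.

Lemma lextU (V : lmodType K) (f : word -> V) w : lext f << w >> = f w.
Proof. by rewrite /lext msuppU oner_eq0 big_seq_fset1 mcoeffUU scale1r. Qed.

Lemma lext_id (t : {malg K[word]}) : lext (fun w => << w >>) t = t.
Proof.
rewrite {2}[t]monalgE; apply: eq_bigr => w _; apply/malgP => u.
by rewrite mcoeffZ !mcoeffU mulr_natr.
Qed.

Lemma lext_ext (V : lmodType K) (f g : {malg K[word]} -> V) :
  linear f -> linear g -> (forall w, f << w >> = g << w >>) -> f =1 g.
Proof.
move=> hf hg fg t; rewrite -[t]lext_id /lext !lin_sum //.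
by apply: eq_bigr => w _; rewrite !linZ // fg.
Qed.

Lemma talg_gpr_linear g : linear (talg_gpr g).
Proof. exact: lext_linear. Qed.

Lemma talg_gpr_gpr g h t :
  talg_gpr g (talg_gpr h t) = if g == h then talg_gpr h t else 0.
Proof.
have lg := talg_gpr_linear g; have lh := talg_gpr_linear h.
apply: (@lext_ext _ (fun t => talg_gpr g (talg_gpr h t))
  (fun t => if g == h then talg_gpr h t else 0)) => [k x y|k x y|w].
- by rewrite lh lg.
- by case: ifP => _; rewrite ?lh // scaler0 addr0.
rewrite /talg_gpr !lextU; case: (h =P wdeg w) => [->|hw].
  by rewrite lextU.
by rewrite lin0; [case: ifP | exact: lext_linear].
Qed.

Lemma talg_gpr_sum t : exists2 s, uniq s & t = \sum_(g <- s) talg_gpr g t.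
Proof.
exists (undup [seq wdeg w | w <- msupp t]); first exact: undup_uniq.
rewrite /talg_gpr /lext exchange_big -{1}[t]lext_id /lext.
apply: eq_big_seq => w wt; rewrite -scaler_sumr; congr (_ *: _).
rewrite (bigD1_seq (wdeg w)) ?undup_uniq ?mem_undup ?map_f //= eqxx.
by rewrite big1 ?addr0 // => g /negbTE ->.
Qed.

Definition talg : gvect K Γ := GVect talg_gpr_linear talg_gpr_gpr talg_gpr_sum.

Definition twd (w : word) : talg := << w >>.

(* The scalar of (X^⊗k) ⊗ (X^⊗l) -> X^⊗(k+l) obtained by rebracketing. *)
Fixpoint rebracket (u v : word) : K :=
  if u is i :: u' then omega c (a i) (wdeg u') (wdeg v) * rebracket u' v else 1.

Definition talg_mul : gtens talg talg -> talg :=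
  tlift (fun s t : talg =>
    lext (fun u => lext (fun v => rebracket u v *: twd (u ++ v)) t) s).

(* Multiplicative extensions of x |-> 1 ⊗ x + x ⊗ 1, x |-> 0 and the braided
   antimultiplicative extension of x |-> - x. *)
Fixpoint talg_comul_word (w : word) : gtens talg talg :=
  if w is i :: w' then
    mul2 talg_mul (twd [::] ⊗ twd [:: i] + twd [:: i] ⊗ twd [::])
                  (talg_comul_word w')
  else twd [::] ⊗ twd [::].

Fixpoint talg_antipode_word (w : word) : talg :=
  if w is i :: w' then
    sigma c (a i) (wdeg w') *:
      talg_mul (talg_antipode_word w' ⊗ (- twd [:: i]))
  else twd [::].

Definition talg_hopf : hopf_ops talg := HopfOps
  talg_mul (twd [::]) (lext talg_comul_word)
  (fun t : talg => (t : {malg K[word]})@_[::]) (lext talg_antipode_word).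

Definition talg_length (k : nat) (t : talg) : talg :=
  lext (fun w => if size w == k then twd w else 0) t.

Record graded_hopf_ideal_ge2 (I : set talg) : Prop := GradedHopfIdealGe2 {
  ghi_ideal : hopf_ideal talg_hopf I;
  ghi_graded : forall k t, I t -> I (talg_length k t);
  ghi_ge2 : forall k t, I t -> (k < 2)%N -> talg_length k t = 0
}.

Record is_nichols (B : hopfAlg) (p : talg -> B) : Prop := IsNichols {
  nichols_morph : hopf_morph talg_hopf (hops B) p;
  nichols_surj : forall b, exists t, p t = b;
  nichols_ker : graded_hopf_ideal_ge2 [set t | p t = 0];
  nichols_max : forall I, graded_hopf_ideal_ge2 I -> I `<=` [set t | p t = 0]
}.

Definition content (w : word) : {ffun 'I_n -> nat} := [ffun k => count_mem k w].

Definition bar (d : {ffun 'I_n -> nat}) : Γ := \sum_k a k *+ d k.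

(* The homogeneous component of degree d of the quotient B of the tensor
   algebra, for the grading by N^n. *)
Definition ncomp (B : hopfAlg) (p : talg -> B) (d : {ffun 'I_n -> nat}) : set B :=
  [set p t | t in [set t : talg |
     forall w, (t : {malg K[word]})@_w != 0 -> content w = d]].

Definition nsupp (B : hopfAlg) (p : talg -> B) : set {ffun 'I_n -> nat} :=
  [set d | exists2 b, ncomp p d b & b != 0].

Definition sufficiently_unrolled (B : hopfAlg) (p : talg -> B) : Prop :=
  forall d1 d2 d3, nsupp p d1 -> nsupp p d2 -> nsupp p d3 ->
    bar d1 + bar d2 = bar d3 -> d1 + d2 = d3.

End TensorAlgebra.
End BraidedStructure.

(* Main.v *)
(* Since 0 is in the support, unrolledness makes the bar map injective on the
   support of B. Any Hopf algebra N isomorphic to B as a graded space therefore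
   inherits the grading by N^n: its unit spans degree 0, and degree a_i is a line
   whose elements are primitive, because (0, α_i) and (α_i, 0) are the only pairs
   in the support with sum α_i. This gives a Hopf map f from the tensor algebra to
   N whose kernel is a graded Hopf ideal in lengths at least 2, hence is contained
   in the kernel of p. In each degree of Γ the space B is finite-dimensional and N
   has the same dimension, so f is onto and ker f = ker p. *)
Require Import Defs.
From mathcomp Require Import all_boot all_order all_algebra complex reals.
From mathcomp Require Import boolp classical_sets fsbigop finmap monalg.

Set Implicit Arguments.
Unset Strict Implicit.
Unset Printing Implicit Defensive.
Import GRing.Theory.
Local Open Scope ring_scope.

(** * Linear algebra *)

Section LinearAlgebra.
Context (K : fieldType).
Implicit Types V W : lmodType K.

Definition subspace V (P : V -> Prop) : Prop :=
  P 0 /\ forall k x y, P x -> P y -> P (k *: x + y).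

Lemma subspaceD V (P : V -> Prop) x y : subspace P -> P x -> P y -> P (x + y).
Proof. by move=> [_ hP] Px Py; rewrite -[x]scale1r; exact: hP. Qed.

Lemma subspaceZ V (P : V -> Prop) k x : subspace P -> P x -> P (k *: x).
Proof. by move=> [P0 hP] Px; rewrite -[_ *: _]addr0; exact: hP. Qed.

Lemma subspaceB V (P : V -> Prop) x y : subspace P -> P x -> P y -> P (x - y).
Proof. by move=> hP Px Py; rewrite addrC -scaleN1r; exact: hP.2. Qed.

Lemma subspace_sum V (P : V -> Prop) I (r : seq I) (F : I -> V) : subspace P ->
  (forall i, P (F i)) -> P (\sum_(i <- r) F i).
Proof.
move=> hP hF; elim/big_ind: _ => //; first exact: hP.1.
by move=> x y; exact: subspaceD.
Qed.

Lemma linB V W (f : V -> W) x y : linear f -> f (x - y) = f x - f y.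
Proof. by move=> hf; rewrite linD // -scaleN1r linZ // scaleN1r. Qed.

Lemma ker_subspace V W (f : V -> W) : linear f -> subspace (fun x => f x = 0).
Proof.
move=> hf; split=> [|k x y ex ey]; first exact: lin0.
by rewrite hf ex ey scaler0 addr0.
Qed.

Lemma im_subspace V W (f : V -> W) : linear f ->
  subspace (fun y => exists x, y = f x).
Proof.
move=> hf; split=> [|k _ _ [x ->] [y ->]]; first by exists 0; rewrite lin0.
by exists (k *: x + y); rewrite hf.
Qed.

(** Zorn's lemma is applied to the linearly closed sets that meet [P] only in 0. If [v] were not in
    [P] plus a maximal such set, adjoining the line through [v] would enlarge that set. *)
Lemma complement V (P : V -> Prop) : subspace P -> exists D : V -> Prop,
  [/\ subspace D, (forall x, P x -> D x -> x = 0) &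
      forall v, exists x y, [/\ P x, D y & v = x + y]].
Proof.
(* Membership of [0] is left out of [Q], since the union of the empty chain is empty. [D0] recovers
   it: a maximal set without [0] would be empty, hence smaller than the zero subspace. *)
move=> sP; pose Q (D : set V) :=
  (forall k x y, D x -> D y -> D (k *: x + y)) /\ forall x, P x -> D x -> x = 0.
have [F FQ tF|D [[lD iD] mD]] := @Zorn_bigcup V Q.
  split=> [k x y [X FX Xx] [Y FY Yy]|x Px [X FX Xx]]; last exact: (FQ _ FX).2 Xx.
  have [XY|YX] := tF X Y FX FY.
    by exists Y => //; apply: (FQ _ FY).1 => //; exact: XY.
  by exists X => //; apply: (FQ _ FX).1 => //; exact: YX.
have D0 : D 0.
  apply: contrapT => nD0; apply: (mD [set 0]%classic); last first.
    split=> [k x y -> ->|x _ -> //]; by rewrite scaler0 addr0.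
  split=> [x Dx|/(_ 0 erefl) //]; case: nD0.
  by rewrite -(addNr x) -scaleN1r; exact: lD.
have sD : subspace D by [].
exists D; split=> // v; apply: contrapT => nv.
pose E : set V := [set y | exists k, exists2 d, D d & y = k *: v + d]%classic.
apply: (mD E).
  split=> [d Dd|/(_ v) vE]; first by exists 0, d => //; rewrite scale0r add0r.
  apply: nv; exists 0, v; split; [exact: sP.1| |by rewrite add0r].
  by apply: vE; exists 1, 0 => //; rewrite scale1r addr0.
split=> [k x y [k1 [d1 h1 ->]] [k2 [d2 h2 ->]]|x Px [k [d Dd ex]]].
  exists (k * k1 + k2), (k *: d1 + d2); first exact: lD.
  by rewrite scalerDr scalerDl scalerA addrACA.
have [k0|k0] := eqVneq k 0.
  by apply: iD => //; rewrite ex k0 scale0r add0r.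
case: nv; exists (k^-1 *: x), (- k^-1 *: d).
split; [exact: subspaceZ|exact: subspaceZ|].
by rewrite ex scalerDr scalerA mulVf // scale1r scaleNr addrK.
Qed.

(** With complements [D] of the kernel and [E] of the image, [g w] is the only element of [D] whose
    image differs from [w] by an element of [E]; uniqueness makes [g] linear. Dimensions are
    arbitrary, as the result serves the tensor algebra. *)
Lemma linear_section V W (f : V -> W) : linear f ->
  exists2 g : W -> V, linear g & forall x, f (g (f x)) = f x.
Proof.
move=> lf.
have [D [sD iD tD]] := complement (ker_subspace lf).
have [E [sE iE tE]] := complement (im_subspace lf).
have ex w : exists x, D x /\ E (w - f x).
  have [_ [y [[v ->] Ey ->]]] := tE w; have [x1 [x2 [k1 Dx2 ->]]] := tD v.
  by exists x2; rewrite linD // k1 add0r addrC addKr.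
have un w x y : D x /\ E (w - f x) -> D y /\ E (w - f y) -> x = y.
  move=> [Dx ex'] [Dy ey]; apply/subr0_eq; apply: iD; last exact: subspaceB.
  apply: iE; first by exists (x - y).
  have -> : f (x - y) = (w - f y) - (w - f x).
    by rewrite (linB _ _ lf) opprB [RHS]addrC addrA subrK.
  exact: subspaceB.
pose g w := projT1 (cid (ex w)).
have gP w : D (g w) /\ E (w - f (g w)) by rewrite /g; case: cid.
exists g => [k x y|x].
  have [Dx ex'] := gP x; have [Dy ey] := gP y.
  apply: un (gP _) _; split; first exact: sD.2.
  have -> : k *: x + y - f (k *: g x + g y) =
      k *: (x - f (g x)) + (y - f (g y)).
    by rewrite lf scalerBr opprD addrACA.
  exact: sE.2.
have [_ h] := gP (f x); apply/esym/subr0_eq; apply: iE => //.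
by exists (x - g (f x)); rewrite (linB _ _ lf).
Qed.

(** Among the matrices whose row space lies in [P], take one of maximal rank: adjoining a row from
    [P] cannot raise its rank, so that row already lies in its row space. *)
Lemma subspace_row m (P : 'rV[K]_m -> Prop) : subspace P ->
  exists S : 'M[K]_m, forall v, P v <-> (v <= S)%MS.
Proof.
move=> sP; pose q r := `[< exists S : 'M[K]_m,
  \rank S = r /\ forall v : 'rV_m, (v <= S)%MS -> P v >].
have q0 : exists r, q r.
  exists 0%N; apply/asboolP; exists 0; split; first exact: mxrank0.
  by move=> v; rewrite submx0 => /eqP ->; exact: sP.1.
have qm r : q r -> (r <= m)%N by move=> /asboolP[S [<- _]]; exact: rank_leq_row.
case: (ex_maxnP q0 qm) => r /asboolP[S [rS SP]] rmax.
exists S => v; split=> [Pv|]; last exact: SP.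
have /rmax : q (\rank (S + v)%MS).
  apply/asboolP; exists (S + v)%MS; split=> // u /sub_addsmxP[[u1 u2] -> /=].
  apply: subspaceD => //; first by apply: SP; exact: submxMl.
  by rewrite [u2]mx11_scalar mul_scalar_mx; exact: subspaceZ.
rewrite -rS (geq_leqif (mxrank_leqif_sup (addsmxSl S v))).
by apply: submx_trans; exact: addsmxSr.
Qed.

(* Writing [h v = b (v *m M)], the hypotheses say that the preimage of [ker b]
   under [M] is contained in [ker b]; compare dimensions. *)
Lemma finite_dim_comparison m V (b h : 'rV[K]_m -> V) :
  linear b -> linear h ->
  (forall v, exists u, h v = b u) -> (forall v, h v = 0 -> b v = 0) ->
  (forall v, exists u, b v = h u) /\ (forall v, b v = 0 -> h v = 0).
Proof.
move=> lb lh imh kerh.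
have [S bS] := subspace_row (ker_subspace lb).
pose M := \matrix_(i < m) projT1 (cid (imh (delta_mx 0 i))).
have hM v : h v = b (v *m M).
  rewrite mulmx_sum_row [in LHS](row_sum_delta v) (lin_sum _ _ _ lh) (lin_sum _ _ _ lb).
  apply: eq_bigr => i _; rewrite (linZ _ _ lh) (linZ _ _ lb) rowK.
  by case: cid => u /= ->.
pose C := cokermx S.
have bC v : b v = 0 <-> v *m C = 0.
  by rewrite bS submxE; split=> [/eqP|->].
have kMC : (kermx (M *m C) <= kermx C)%MS.
  apply/row_subP => i; apply/sub_kermxP/bC/kerh; rewrite hM; apply/bC.
  by rewrite -mulmxA -row_mul mulmx_ker row0.
(* Multiplication by [M] cannot raise the rank, so [C] and [M *m C] have the same row space, which
   yields the first claim, and the same kernel, which yields the second. *)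
have rMC : (\rank C <= \rank (M *m C))%N.
  have := mxrankS kMC; rewrite !mxrank_ker.
  by rewrite leq_sub2lE ?rank_leq_row.
have sMC : (C <= M *m C)%MS.
  by rewrite -(geq_leqif (mxrank_leqif_sup (submxMl M C))).
split=> v.
  have /submxP[u eu] : (v *m C <= M *m C)%MS by apply: submx_trans sMC; exact: submxMl.
  exists u; apply/subr0_eq; rewrite hM -(linB _ _ lb); apply/bC.
  by rewrite mulmxBl eu mulmxA subrr.
move=> /bC /sub_kermxP vC; rewrite hM; apply/bC; rewrite -mulmxA; apply/sub_kermxP.
apply: submx_trans vC _; rewrite -(geq_leqif (mxrank_leqif_sup kMC)) !mxrank_ker.
by apply: leq_sub2l; exact: mxrankM_maxr.
Qed.

End LinearAlgebra.

(** * Tensor products and gradings *)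

Section Tensors.
Context (K : fieldType).
Implicit Types V W : lmodType K.

Lemma tprodZl V W k (v : V) (w : W) : (k *: v) ⊗ w = k *: (v ⊗ w).
Proof. exact: (linZ _ _ ((tprod_bilin V W).1 w)). Qed.

Lemma tprodZr V W k (v : V) (w : W) : v ⊗ (k *: w) = k *: (v ⊗ w).
Proof. exact: (linZ _ _ ((tprod_bilin V W).2 v)). Qed.

Lemma tprodDl V W (v v' : V) (w : W) : (v + v') ⊗ w = v ⊗ w + v' ⊗ w.
Proof. exact: (linD _ _ ((tprod_bilin V W).1 w)). Qed.

Lemma tprodDr V W (v : V) (w w' : W) : v ⊗ (w + w') = v ⊗ w + v ⊗ w'.
Proof. exact: (linD _ _ ((tprod_bilin V W).2 v)). Qed.

Lemma tprodBl V W (v v' : V) (w : W) : (v - v') ⊗ w = v ⊗ w - v' ⊗ w.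
Proof. exact: (linB _ _ ((tprod_bilin V W).1 w)). Qed.

Lemma tprodBr V W (v : V) (w w' : W) : v ⊗ (w - w') = v ⊗ w - v ⊗ w'.
Proof. exact: (linB _ _ ((tprod_bilin V W).2 v)). Qed.

Lemma tens_ind V W (P : tens V W -> Prop) : P 0 ->
  (forall s t, P s -> P t -> P (s + t)) -> (forall v w, P (v ⊗ w)) ->
  forall t, P t.
Proof.
move=> P0 PD Pp t; rewrite [t]tens_sum.
by elim/big_ind: _ => // i _; exact: Pp.
Qed.

Lemma id_linear V : linear (@id V). Proof. by []. Qed.

Lemma comp_linear (U V W : lmodType K) (f : V -> W) (g : U -> V) :
  linear f -> linear g -> linear (f \o g).
Proof. by move=> lf lg k x y /=; rewrite lg lf. Qed.

Section Tmap.
Context (V W V' W' : lmodType K) (f : V -> V') (g : W -> W').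
Hypotheses (lf : linear f) (lg : linear g).

Lemma tmap_bilin : bilin (fun v w => f v ⊗ g w).
Proof.
split=> [w|v] k x y; first by rewrite lf tprodDl tprodZl.
by rewrite lg tprodDr tprodZr.
Qed.

Lemma tmap_linear : linear (tmap f g).
Proof. exact: tlift_linear tmap_bilin. Qed.

Lemma tmap_tprod v w : tmap f g (v ⊗ w) = f v ⊗ g w.
Proof. exact: tlift_tprod tmap_bilin. Qed.

End Tmap.

Lemma tmap_comp (V W V' W' V2 W2 : lmodType K) (f : V -> V') (g : W -> W')
    (f' : V' -> V2) (g' : W' -> W2) t :
  linear f -> linear g -> linear f' -> linear g' ->
  tmap f' g' (tmap f g t) = tmap (f' \o f) (g' \o g) t.
Proof.
move=> lf lg lf' lg'; have lff := comp_linear lf' lf; have lgg := comp_linear lg' lg.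
have l1 := tmap_linear lf lg; have l2 := tmap_linear lf' lg'.
have l3 := tmap_linear lff lgg.
elim/tens_ind: t => [|s t es et|v w]; first by rewrite !lin0.
  by rewrite !(linD _ _ l1, linD _ _ l2, linD _ _ l3) es et.
by rewrite !tmap_tprod.
Qed.

(* For [g] linear with [f g f = f], the identity [1 ⊗ 1] is the sum of
   [(1 - g f) ⊗ 1], [g f ⊗ (1 - g f)] and [g f ⊗ g f]. *)
Lemma ker_tmap (V W : lmodType K) (f : V -> W) (t : tens V V) :
  linear f -> tmap f f t = 0 -> exists s : seq (V * V),
    t = \sum_(p <- s) p.1 ⊗ p.2 /\
    (forall p, p \in s -> f p.1 = 0 \/ f p.2 = 0).
Proof.
move=> lf ft; have [g lg gf] := linear_section lf.
pose e := g \o f; have le : linear e by exact: comp_linear.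
have fe x : f (x - e x) = 0 by rewrite (linB _ _ lf) gf subrr.
have et : tmap e e t = 0.
  by rewrite -(tmap_comp _ lf lf lg lg) ft (lin0 (tmap_linear lg lg)).
exists ([seq (p.1 - e p.1, p.2) | p <- trepr t] ++
        [seq (e p.1, p.2 - e p.2) | p <- trepr t]); split; last first.
  move=> p; rewrite mem_cat => /orP[] /mapP[q _ ->] /=; rewrite fe; by [left|right].
rewrite big_cat /= !big_map -big_split /= -[LHS]subr0 -[in LHS]et.
rewrite {1 2}[t]tens_sum (lin_sum _ _ _ (tmap_linear le le)) -sumrB.
apply: eq_bigr => p _; rewrite (tmap_tprod le le).
by rewrite tprodBl tprodBr addrA subrK.
Qed.

End Tensors.

Section Graded.
Context (K : fieldType) (Γ : zmodType).
Implicit Types U V W : gvect K Γ.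

Lemma homog_gpr V g (v : V) : homog g (gpr g v).
Proof. by rewrite /homog gpr_gpr eqxx. Qed.

Lemma homog_subspace V g : subspace (@homog K Γ V g).
Proof.
split=> [|k x y hx hy]; rewrite /homog; first exact: lin0 (gpr_linear g).
by rewrite gpr_linear hx hy.
Qed.

Lemma homog_gmorph V W (f : V -> W) g v : gmorph f -> homog g v -> homog g (f v).
Proof. by move=> [_ hf] hv; rewrite /homog -hf hv. Qed.

Lemma gpr_homog V g h (v : V) : homog h v -> gpr g v = if g == h then v else 0.
Proof. by move=> hv; rewrite -hv gpr_gpr hv. Qed.

Lemma homog_tprod V W g h (v : V) (w : W) : homog g v -> homog h w ->
  homog (g + h) (v ⊗ w : gtens V W).
Proof. by move=> hv hw; rewrite /homog /= (tgpr_homog _ hv hw) eqxx. Qed.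

Lemma gtens_ind V W (P : gtens V W -> Prop) : P 0 ->
  (forall s t, P s -> P t -> P (s + t)) ->
  (forall g h v w, homog g v -> homog h w -> P (v ⊗ w)) -> forall t, P t.
Proof.
move=> P0 PD Pp t; have [s [-> hs]] := tens_homog_sum t.
rewrite big_seq; elim/big_ind: _ => // i /hs [g [h [hg hh]]]; exact: (Pp g h).
Qed.

End Graded.

(** * The braided tensor square *)

Section Braided.
Context (K : fieldType) (Γ : zmodType) (c : abelian3cocycle K Γ).
Implicit Types U V W : gvect K Γ.
Implicit Types x y z t : Γ.

(** With two zeros inserted, the pentagon reads [w * w = w] for the nonzero value [w] in question.
    The pentagon also gives [omega0r], and the second hexagon gives [sigma0l], in the same way. *)
Lemma omega0l x y : omega c 0 x y = 1.
Proof.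
have := pentagon c 0 0 x y.
rewrite !omega_unit !addr0 add0r mul1r mulr1 => h.
by apply: (mulIf (omega_neq0 c 0 x y)); rewrite mul1r.
Qed.

Lemma omega0r x y : omega c x y 0 = 1.
Proof.
have := pentagon c x y 0 0.
rewrite !omega_unit !addr0 mul1r mulr1 => h.
by apply: (mulIf (omega_neq0 c x y 0)); rewrite mul1r.
Qed.

Lemma sigma0l x : sigma c 0 x = 1.
Proof.
have := hexagon2 c 0 0 x.
rewrite addr0 !(omega_unit, omega0l, omega0r) invr1 !mul1r !mulr1.
by move=> h; apply: (mulIf (sigma_neq0 c 0 x)); rewrite mul1r.
Qed.

(** The factors record, in order, the five steps of [interchange]: associator, inverse associator,
    braiding, associator, inverse associator. *)
Definition interchange_scalar x y z t : K :=
  omega c x y (z + t) * (omega c y z t)^-1 * sigma c y z * omega c z y t *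
  (omega c x z (y + t))^-1.

Lemma assoc_linear U V W : linear (@assoc _ _ c U V W).
Proof. exact: tlift_linear (@assoc_bilin _ _ c U V W). Qed.

Lemma associnv_linear U V W : linear (@associnv _ _ c U V W).
Proof. exact: tlift_linear (@associnv_bilin _ _ c U V W). Qed.

Lemma braid_linear V W : linear (@braid _ _ c V W).
Proof. exact: tlift_linear (@braid_bil_bilin _ _ c V W). Qed.

Lemma interchange_homog (A B C D : gvect K Γ) x y z t (u : A) (v : B) (w : C) (r : D) :
  homog x u -> homog y v -> homog z w -> homog t r ->
  Defs.interchange c ((u ⊗ v : gtens A B) ⊗ (w ⊗ r : gtens C D)) =
  interchange_scalar x y z t *: ((u ⊗ w) ⊗ (v ⊗ r)).
Proof.
move=> hu hv hw hr; rewrite /Defs.interchange.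
have l1 := @associnv_linear B C D.
have l2 := tmap_linear (@braid_linear B C) (@id_linear _ D).
have l3 := @assoc_linear C B D.
have l4 := @associnv_linear A C (gtens B D).
have il := @id_linear _ A.
rewrite (assoc_homog c hu hv (homog_tprod hw hr)).
rewrite (linZ _ _ (tmap_linear il l1)) (tmap_tprod il l1).
rewrite (associnv_homog c hv hw hr) tprodZr scalerA.
rewrite (linZ _ _ (tmap_linear il l2)) (tmap_tprod il l2).
rewrite (tmap_tprod (@braid_linear B C) (@id_linear _ D)) (braid_homog c hv hw).
rewrite tprodZl tprodZr scalerA.
rewrite (linZ _ _ (tmap_linear il l3)) (tmap_tprod il l3).
rewrite (assoc_homog c hw hv hr) tprodZr scalerA.
rewrite (linZ _ _ l4) (associnv_homog c hu hw (homog_tprod hv hr)) scalerA.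
by [].
Qed.

Lemma interchange_linear (A B C D : gvect K Γ) : linear (@Defs.interchange _ _ c A B C D).
Proof.
move=> k s r; rewrite /Defs.interchange.
rewrite assoc_linear (tmap_linear (@id_linear _ A) (@associnv_linear B C D)).
rewrite (tmap_linear (@id_linear _ A) (tmap_linear (@braid_linear B C) (@id_linear _ D))).
by rewrite (tmap_linear (@id_linear _ A) (@assoc_linear C B D)) associnv_linear.
Qed.

Section Mul2.
Context (A : gvect K Γ) (m : gtens A A -> A) (lm : linear m).

Lemma mul2_linearl s : linear (fun r => mul2 c m r s).
Proof.
move=> k x y; rewrite /mul2 tprodDl tprodZl interchange_linear.
exact: (tmap_linear lm lm).
Qed.

Lemma mul2_linearr s : linear (mul2 c m s).
Proof.
move=> k x y; rewrite /mul2 tprodDr tprodZr interchange_linear.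
exact: (tmap_linear lm lm).
Qed.

Lemma mul2_homog x y z t (u v w r : A) :
  homog x u -> homog y v -> homog z w -> homog t r ->
  mul2 c m (u ⊗ v) (w ⊗ r) =
  interchange_scalar x y z t *: (m (u ⊗ w) ⊗ m (v ⊗ r)).
Proof.
move=> hu hv hw hr; rewrite /mul2 (interchange_homog hu hv hw hr).
by rewrite (linZ _ _ (tmap_linear lm lm)) (tmap_tprod lm lm).
Qed.

End Mul2.

(** Both sides are bilinear, so homogeneous pure tensors suffice. There [f] preserves the degrees,
    so the same interchange scalar appears on both sides. *)
Lemma mul2_natural (A B : gvect K Γ) (m : gtens A A -> A) (m' : gtens B B -> B)
    (f : A -> B) : linear m -> linear m' -> gmorph f ->
  (forall s, f (m s) = m' (tmap f f s)) ->
  forall s r, tmap f f (mul2 c m s r) = mul2 c m' (tmap f f s) (tmap f f r).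
Proof.
move=> lm lm' gf fm s r; have lf := gf.1; have lff := tmap_linear lf lf.
elim/gtens_ind: s => [|s s' es es'|x y u v hu hv].
- by rewrite (lin0 lff) (lin0 (mul2_linearl lm r)) (lin0 lff) (lin0 (mul2_linearl lm' _)).
- rewrite (linD _ _ lff) (linD _ _ (mul2_linearl lm r)) (linD _ _ lff).
  by rewrite (linD _ _ (mul2_linearl lm' _)) es es'.
elim/gtens_ind: r => [|s s' es es'|z t w q hw hq].
- by rewrite (lin0 lff) (lin0 (mul2_linearr lm _)) (lin0 lff) (lin0 (mul2_linearr lm' _)).
- rewrite (linD _ _ lff) (linD _ _ (mul2_linearr lm _)) (linD _ _ lff).
  by rewrite (linD _ _ (mul2_linearr lm' _)) es es'.
rewrite (mul2_homog lm hu hv hw hq) (linZ _ _ lff) !(tmap_tprod lf lf).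
rewrite !fm !(tmap_tprod lf lf) (mul2_homog lm' (x := x) (y := y) (z := z) (t := t)) //;
  exact: homog_gmorph.
Qed.

(** Since [e] has degree 0, most factors of the interchange scalar become 1. Both summands keep the
    inverse of [omega c x y z]: for [p ⊗ e] it comes from the last rebracketing, for [e ⊗ p] from
    the second one. *)
Lemma mul2_primitive (A : gvect K Γ) (m : gtens A A -> A) (e p u v : A) x y z :
  linear m -> homog 0 e -> (forall u, m (e ⊗ u) = u) -> (forall u, m (u ⊗ e) = u) ->
  homog x p -> homog y u -> homog z v ->
  mul2 c m (e ⊗ p + p ⊗ e) (u ⊗ v) = (omega c x y z)^-1 *:
    (m (p ⊗ u) ⊗ v + (sigma c x y * omega c y x z) *: (u ⊗ m (p ⊗ v))).
Proof.
move=> lm he m1 mr hp hu hv; rewrite (linD _ _ (mul2_linearl lm _)).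
rewrite (mul2_homog lm he hp hu hv) (mul2_homog lm hp he hu hv) !m1.
rewrite /interchange_scalar !(omega0l, omega0r, omega_unit, sigma0l, add0r, invr1, mulr1, mul1r).
rewrite addrC scalerDr scalerA; congr (_ + _ *: _).
by rewrite mulrA.
Qed.

End Braided.

(** * Hopf maps out of the tensor algebra *)

Section TensorAlgebraMaps.
Context (K : fieldType) (Γ : zmodType) (c : abelian3cocycle K Γ).
Context (n : nat) (a : 'I_n -> Γ).
Let T := talg K a.
Notation twd := (@twd K Γ n a).

Lemma talg_lext_linear (V : lmodType K) (F : word n -> V) :
  linear (lext F : T -> V).
Proof. exact: lext_linear. Qed.

Lemma lext_twd (V : lmodType K) (F : word n -> V) w : lext F (twd w) = F w.
Proof. exact: lextU. Qed.

Lemma talg_ext (V : lmodType K) (f g : T -> V) : linear f -> linear g ->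
  (forall w, f (twd w) = g (twd w)) -> f =1 g.
Proof. exact: lext_ext. Qed.

Lemma talg_sum (t : T) : t = \sum_(w <- msupp t) (t : {malg K[word n]})@_w *: twd w.
Proof. exact/esym/lext_id. Qed.

Lemma talg_tens_ext (V : lmodType K) (f g : gtens T T -> V) :
  linear f -> linear g ->
  (forall u v, f (twd u ⊗ twd v) = g (twd u ⊗ twd v)) -> f =1 g.
Proof.
move=> lf lg fg t; suff -> : f = g by [].
apply: tlift_unique => // s r.
have ll (h : gtens T T -> V) y : linear h -> linear (fun x : T => h (x ⊗ y)).
  by move=> lh k u v; rewrite tprodDl tprodZl lh.
have lr (h : gtens T T -> V) x : linear h -> linear (fun y : T => h (x ⊗ y)).
  by move=> lh k u v; rewrite tprodDr tprodZr lh.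
apply: (talg_ext (ll f r lf) (ll g r lg)) => u.
by apply: (talg_ext (lr f _ lf) (lr g _ lg)) => v.
Qed.

Lemma gpr_twd g w : gpr g (twd w) = if g == wdeg a w then twd w else 0.
Proof. exact: lextU. Qed.

Lemma homog_twd w : homog (wdeg a w) (twd w).
Proof. by rewrite /homog gpr_twd eqxx. Qed.

Lemma wdeg_cons i w : wdeg a (i :: w) = a i + wdeg a w.
Proof. exact: big_cons. Qed.

Lemma wdeg_nil : wdeg a [::] = 0. Proof. exact: big_nil. Qed.

Lemma wdeg1 i : wdeg a [:: i] = a i.
Proof. by rewrite wdeg_cons wdeg_nil addr0. Qed.

Lemma lext_gmorph (V : gvect K Γ) (F : word n -> V) :
  (forall w, homog (wdeg a w) (F w)) -> gmorph (lext F : T -> V).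
Proof.
move=> hF; have l := talg_lext_linear F; split=> // g.
apply: (talg_ext (f := fun t => lext F (gpr g t)) (g := fun t => gpr g (lext F t))).
- by move=> k x y; rewrite gpr_linear l.
- by move=> k x y; rewrite l gpr_linear.
move=> w; rewrite gpr_twd lext_twd (gpr_homog _ (hF w)).
by case: ifP => _; rewrite ?lext_twd // (lin0 l).
Qed.

Lemma talg_mul_bilin : bilin (fun s t : T =>
  lext (fun u => lext (fun v => rebracket c a u v *: twd (u ++ v)) t) s).
Proof.
split=> [t|s] k x y; first exact: talg_lext_linear.
rewrite /lext -/(lext _ _) scaler_sumr -big_split /=; apply: eq_bigr => w _.
by rewrite [X in _ *: X = _]talg_lext_linear scalerDr !scalerA mulrC.
Qed.

Lemma talg_mul_linear : linear (talg_mul c (a := a)).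
Proof. exact: tlift_linear talg_mul_bilin. Qed.

Lemma talg_mul_twd u v :
  talg_mul c (twd u ⊗ twd v) = rebracket c a u v *: twd (u ++ v).
Proof. by rewrite /talg_mul (tlift_tprod _ _ talg_mul_bilin) !lext_twd. Qed.

Lemma talg_mul1l u : talg_mul c (twd [::] ⊗ u) = u.
Proof.
apply: (talg_ext (f := fun u : T => talg_mul c (twd [::] ⊗ u)) (g := id)) => // [k x y|w].
  by rewrite tprodDr tprodZr talg_mul_linear.
by rewrite talg_mul_twd scale1r.
Qed.

Lemma rebracket0 w : rebracket c a w [::] = 1.
Proof. by elim: w => //= i w ->; rewrite wdeg_nil omega0r mulr1. Qed.

Lemma talg_mul1r u : talg_mul c (u ⊗ twd [::]) = u.
Proof.
apply: (talg_ext (f := fun u : T => talg_mul c (u ⊗ twd [::])) (g := id)) => // [k x y|w].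
  by rewrite tprodDl tprodZl talg_mul_linear.
by rewrite talg_mul_twd rebracket0 scale1r cats0.
Qed.

Lemma talg_mul_letter i w : talg_mul c (twd [:: i] ⊗ twd w) = twd (i :: w).
Proof. by rewrite talg_mul_twd /= wdeg_nil omega_unit mulr1 scale1r. Qed.

Definition letter_comul i : gtens T T :=
  twd [::] ⊗ twd [:: i] + twd [:: i] ⊗ twd [::].

Lemma mul2_letter i u v :
  mul2 c (talg_mul c (a := a)) (letter_comul i) (twd u ⊗ twd v) =
  (omega c (a i) (wdeg a u) (wdeg a v))^-1 *: (twd (i :: u) ⊗ twd v +
    (sigma c (a i) (wdeg a u) * omega c (wdeg a u) (a i) (wdeg a v)) *:
    (twd u ⊗ twd (i :: v))).
Proof.
have hi := homog_twd [:: i]; rewrite wdeg1 in hi.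
have h0 := homog_twd [::]; rewrite wdeg_nil in h0.
rewrite (mul2_primitive c talg_mul_linear h0 talg_mul1l talg_mul1r hi
  (homog_twd u) (homog_twd v)).
by rewrite !talg_mul_letter.
Qed.

(** The coproduct of [w] is [w ⊗ 1] plus tensors whose first factor is a shorter word. Testing with
    a linear map [L] that kills the latter avoids a filtration on the tensor square. The leading
    coefficient is 1 because [omega] is 1 when its last argument is 0. *)
Lemma comul_word_leading w (V : lmodType K) (L : gtens T T -> V) : linear L ->
  (forall u v, (size u < size w)%N -> L (twd u ⊗ twd v) = 0) ->
  L (talg_comul_word c a w) = L (twd w ⊗ twd [::]).
Proof.
elim: w L => [//|i w IH] L lL hL /=.
have l2 := mul2_linearr c talg_mul_linear (letter_comul i).
(* The induction hypothesis is used for [L] composed with multiplication by the coproduct of the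
   letter, which lengthens the first factor by at most one letter. *)
have := IH _ (comp_linear lL l2); rewrite /= -/(letter_comul i) => -> //.
  rewrite mul2_letter (linZ _ _ lL) (linD _ _ lL) (linZ _ _ lL).
  by rewrite (hL w) // scaler0 addr0 wdeg_nil omega0r invr1 scale1r.
move=> u v uw; rewrite mul2_letter (linZ _ _ lL) (linD _ _ lL) (linZ _ _ lL).
by rewrite !hL ?scaler0 ?addr0 ?scaler0 //=; exact: ltnW.
Qed.

(** * Extension of primitive elements to a Hopf map *)

Section Lift.
Context (N : hopfAlg c) (x : 'I_n -> N).
Hypothesis hx : forall i, homog (a i) (x i).
Hypothesis primx : forall i,
  hcomul (hops N) (x i) = hone (hops N) ⊗ x i + x i ⊗ hone (hops N).

Let H := hopfP N.
Notation m := (hmul (hops N)).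
Notation one := (hone (hops N)).
Let lm : linear m := (hmul_gmorph H).1.

Definition lift_word : word n -> N := foldr (fun i y => hmul (hops N) (x i ⊗ y)) one.
Definition talg_lift : T -> N := lext lift_word.
Notation f := talg_lift.

Lemma homog_mul g h u v : homog g u -> homog h v -> homog (g + h) (m (u ⊗ v)).
Proof.
by move=> hu hv; apply: (homog_gmorph (hmul_gmorph H)); exact: homog_tprod.
Qed.

Lemma homog_lift_word w : homog (wdeg a w) (lift_word w).
Proof.
elim: w => [|i w IH]; first by rewrite wdeg_nil; exact: hone_homog H.
by rewrite wdeg_cons; exact: homog_mul.
Qed.

Lemma talg_lift_gmorph : gmorph f.
Proof. exact: lext_gmorph homog_lift_word. Qed.

Let lf : linear f := talg_lift_gmorph.1.

Lemma talg_lift_twd w : f (twd w) = lift_word w.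
Proof. exact: lext_twd. Qed.

Lemma talg_lift1 i : f (twd [:: i]) = x i.
Proof. by rewrite talg_lift_twd; exact: hmul1r H _. Qed.

Lemma hmulA_homog g h k u v w : homog g u -> homog h v -> homog k w ->
  m (m (u ⊗ v) ⊗ w) = omega c g h k *: m (u ⊗ m (v ⊗ w)).
Proof.
move=> hu hv hw; have := hmulA H ((u ⊗ v : gtens N N) ⊗ w).
rewrite (tmap_tprod lm (@id_linear _ N)) (assoc_homog c hu hv hw).
rewrite (linZ _ _ (tmap_linear (@id_linear _ N) lm)) (tmap_tprod (@id_linear _ N) lm).
by rewrite (linZ _ _ lm).
Qed.

(** Products of generators are bracketed to the right, so each letter of [u] costs one associator;
    their product is [rebracket]. *)
Lemma lift_word_cat u v :
  m (lift_word u ⊗ lift_word v) = rebracket c a u v *: lift_word (u ++ v).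
Proof.
elim: u => [|i u IH] /=; first by rewrite scale1r; exact: hmul1l H _.
rewrite (hmulA_homog (hx i) (homog_lift_word u) (homog_lift_word v)) IH.
by rewrite tprodZr (linZ _ _ lm) scalerA.
Qed.

Lemma talg_lift_mul t : f (talg_mul c t) = m (tmap f f t).
Proof.
apply: (talg_tens_ext (f := f \o talg_mul c (a := a)) (g := m \o tmap f f)).
- exact: comp_linear lf talg_mul_linear.
- exact: comp_linear lm (tmap_linear lf lf).
move=> u v /=; rewrite talg_mul_twd (linZ _ _ lf) (tmap_tprod lf lf).
by rewrite !talg_lift_twd lift_word_cat.
Qed.

(** Both sides are multiplicative on words, by the bialgebra axiom of [N] and by [mul2_natural],
    which reduces the claim to letters, where it is primitivity. *)
Lemma talg_lift_comul t :
  hcomul (hops N) (f t) = tmap f f (hcomul (talg_hopf c a) t).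
Proof.
have lc := (hcomul_gmorph H).1; have lff := tmap_linear lf lf.
apply: (talg_ext (f := hcomul (hops N) \o f)
    (g := tmap f f \o lext (talg_comul_word c a))).
- exact: comp_linear lc lf.
- exact: comp_linear lff (talg_lext_linear _).
move=> w /=; rewrite lext_twd talg_lift_twd; elim: w => [|i w IH] /=.
  by rewrite (tmap_tprod lf lf) !talg_lift_twd; exact: hcomul1 H.
rewrite (mul2_natural c talg_mul_linear lm talg_lift_gmorph talg_lift_mul).
rewrite -IH (linD _ _ lff) !(tmap_tprod lf lf) talg_lift1 talg_lift_twd -primx.
exact: hcomulM H _ _.
Qed.

Hypothesis counitx : forall i, hcounit (hops N) (x i) = 0.

Lemma talg_lift_counit t :
  hcounit (hops N) (f t) = hcounit (talg_hopf c a) t.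
Proof.
have lc := (hcounit_gmorph H).1.
apply: (talg_ext (V := K^o) (f := hcounit (hops N) \o f)
  (g := hcounit (talg_hopf c a))).
- exact: comp_linear lc lf.
- by move=> k u v /=; rewrite mcoeffD mcoeffZ.
move=> w /=; rewrite talg_lift_twd mcoeffU; case: w => [|i w] /=.
  exact: hcounit1 H.
by rewrite (hcounitM H) counitx mul0r.
Qed.

Let lift_antipode : T -> N := lext (fun w => f (talg_antipode_word c a w)).
Notation fS := lift_antipode.

Let lfS : linear fS. Proof. exact: talg_lext_linear. Qed.

Lemma lift_antipode_cons i w :
  fS (twd (i :: w)) = - sigma c (a i) (wdeg a w) *: m (fS (twd w) ⊗ x i).
Proof.
rewrite /lift_antipode !lext_twd /= (linZ _ _ lf) talg_lift_mul.
rewrite (tmap_tprod lf lf) -scaleN1r (linZ _ _ lf) talg_lift1 tprodZr (linZ _ _ lm).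
by rewrite scalerA mulrN1.
Qed.

Lemma lift_antipode_homog w : homog (wdeg a w) (fS (twd w)).
Proof.
elim: w => [|i w IH].
  rewrite /lift_antipode lext_twd; apply: (homog_gmorph talg_lift_gmorph).
  exact: homog_twd.
rewrite lift_antipode_cons; apply: subspaceZ; first exact: homog_subspace.
by rewrite wdeg_cons addrC; exact: homog_mul.
Qed.

(* The contributions of [x_i ⊗ 1] and of [1 ⊗ x_i] to [Δ(x_i) (u ⊗ v)] cancel
   for all [u] and [v]. *)
Lemma lift_antipode_convolution i w :
  m (tmap fS f (talg_comul_word c a (i :: w))) = 0.
Proof.
have l2 := mul2_linearr c talg_mul_linear (letter_comul i).
have lt := tmap_linear lfS lf.
rewrite /= -/(letter_comul i).
apply: (talg_tens_ext (f := (m \o tmap fS f) \o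
  mul2 c (talg_mul c (a := a)) (letter_comul i)) (g := fun=> 0)).
- exact: comp_linear (comp_linear lm lt) l2.
- by move=> k u v; rewrite scaler0 addr0.
move=> u v /=; rewrite mul2_letter (linZ _ _ lt) (linD _ _ lt) (linZ _ _ lt).
rewrite !(tmap_tprod lfS lf) (linZ _ _ lm) (linD _ _ lm) (linZ _ _ lm).
rewrite lift_antipode_cons tprodZl (linZ _ _ lm) !talg_lift_twd /=.
rewrite (hmulA_homog (lift_antipode_homog u) (hx i) (homog_lift_word v)).
by rewrite scalerA mulNr scaleNr addNr scaler0.
Qed.

(* Both sides are left convolution inverses of [f], and the convolution equation
   determines the value on a word from the values on shorter words. *)
Lemma talg_lift_antipode t :
  hantipode (hops N) (f t) = f (hantipode (talg_hopf c a) t).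
Proof.
have lS := (hantipode_gmorph H).1; have lSf := comp_linear lS lf.
have lt1 := tmap_linear lSf lf; have lt2 := tmap_linear lfS lf.
apply: (talg_ext (f := hantipode (hops N) \o f)
  (g := f \o lext (talg_antipode_word c a))) => //.
  exact: comp_linear lf (talg_lext_linear _).
move=> w /=; have -> : f (lext (talg_antipode_word c a) (twd w)) = fS (twd w).
  by rewrite /lift_antipode !lext_twd.
have [k] := ubnP (size w); elim: k w => // k IH [_|i w /=].
  rewrite talg_lift_twd /lift_antipode lext_twd /= talg_lift_twd /=.
  have := hantipodel H one; rewrite (hcomul1 H) (hcounit1 H) scale1r.
  by rewrite (tmap_tprod lS (@id_linear _ N)) (hmul1r H).
rewrite ltnS => wk.
(* By induction [L] kills the tensors whose first factor is a shorter word. So [comul_word_leading]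
   identifies its value on the coproduct of the word with the difference of the two sides on that
   word. *)
pose L t := m (tmap (hantipode (hops N) \o f) f t) - m (tmap fS f t).
have lL : linear L.
  move=> k' u v; rewrite /L (linD _ _ lt1) (linD _ _ lt2) !(linD _ _ lm).
  rewrite (linZ _ _ lt1) (linZ _ _ lt2) !(linZ _ _ lm).
  by rewrite scalerBr opprD addrACA.
have := @comul_word_leading (i :: w) N L lL.
rewrite {2 3}/L (tmap_tprod lSf lf) (tmap_tprod lfS lf) lift_antipode_convolution subr0.
rewrite talg_lift_twd /= !(hmul1r H) => E.
apply/subr0_eq; rewrite -E; last first.
  move=> u v us; rewrite /L (tmap_tprod lSf lf) (tmap_tprod lfS lf) /=.
  by rewrite IH ?subrr //; exact: leq_trans us wk.
have -> : tmap (hantipode (hops N) \o f) f (talg_comul_word c a (i :: w)) =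
    tmap (hantipode (hops N)) id (hcomul (hops N) (f (twd (i :: w)))).
  rewrite talg_lift_comul /= lext_twd.
  by rewrite (tmap_comp _ lf lf lS (@id_linear _ N)).
rewrite (hantipodel H) talg_lift_counit /= mcoeffU /=.
by rewrite scale0r.
Qed.

End Lift.
End TensorAlgebraMaps.

(** * Comparison with the Nichols algebra *)

Section Content.
Context (n : nat).
Implicit Types u v w : word n.

Lemma content_nil : content ([::] : word n) = 0.
Proof. by apply/ffunP => k; rewrite !ffunE. Qed.

Lemma content_cons i w : content (i :: w) = content [:: i] + content w.
Proof. by apply/ffunP => k; rewrite !ffunE /= addn0. Qed.

Lemma content_perm u v : content u = content v -> perm_eq u v.
Proof.
by move=> /ffunP uv; apply/allP => k _ /=; have := uv k; rewrite !ffunE => ->.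
Qed.

Lemma content_letter_split i (d1 d2 : {ffun 'I_n -> nat}) :
  d1 + d2 = content [:: i] ->
  d1 = 0 /\ d2 = content [:: i] \/ d1 = content [:: i] /\ d2 = 0.
Proof.
move=> dd; have dk k : (d1 k + d2 k = (i == k))%N.
  by have /ffunP/(_ k) := dd; rewrite !ffunE /= addn0.
have [d0|d0] := eqVneq (d1 i) 0%N.
  left; suff d10 : d1 = 0 by rewrite -dd d10 add0r.
  apply/ffunP => k; rewrite ffunE; have := dk k; case: eqP => [<- //|_ /eqP].
  by rewrite addn_eq0 => /andP[/eqP].
right; suff d20 : d2 = 0 by rewrite -dd d20 addr0.
apply/ffunP => k; rewrite ffunE; have := dk k; case: eqP => [<-|_ /eqP].
  by case: (d1 i) d0 => //= j _; rewrite addSn => -[] /eqP; rewrite addn_eq0 => /andP[_ /eqP].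
by rewrite addn_eq0 => /andP[_ /eqP].
Qed.

Lemma bar_content (Γ : zmodType) (a : 'I_n -> Γ) w : bar a (content w) = wdeg a w.
Proof.
elim: w => [|i w IH].
  by rewrite wdeg_nil content_nil /bar big1 // => k _; rewrite ffunE.
rewrite wdeg_cons -IH content_cons /bar.
under eq_bigr => k _ do rewrite ffunE mulrnDr.
rewrite big_split /=; congr (_ + _).
rewrite (bigD1 i) //= big1 ?addr0 => [|k ki]; rewrite ffunE /= addn0.
  by rewrite eqxx.
by rewrite eq_sym (negbTE ki).
Qed.

Lemma wdeg_perm (Γ : zmodType) (a : 'I_n -> Γ) u v :
  perm_eq u v -> wdeg a u = wdeg a v.
Proof. exact: perm_big. Qed.

End Content.

(** * Consequences of unrolledness for the Nichols algebra *)

Section Nichols.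
Context (K : fieldType) (Γ : zmodType) (c : abelian3cocycle K Γ).
Context (n : nat) (a : 'I_n -> Γ).
Notation T := (talg K a).
Notation twd := (@twd K Γ n a).
Context (B : hopfAlg c) (p : T -> B).
Hypothesis nich : is_nichols p.
Hypothesis unr : sufficiently_unrolled p.

Let gp : gmorph p := hm_gmorph (nichols_morph nich).
Let lp : linear p := gp.1.

Lemma talg_homog_span (P : T -> Prop) g t : subspace P ->
  (forall w, wdeg a w = g -> P (twd w)) -> homog g t -> P t.
Proof.
move=> sP Pw ht; rewrite -ht [t]talg_sum (lin_sum _ _ _ (gpr_linear g)).
apply: subspace_sum => // w; rewrite (linZ _ _ (gpr_linear g)) gpr_twd.
apply: subspaceZ => //; case: eqP => [gw|_]; [exact: Pw|exact: sP.1].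
Qed.

Lemma nichols_homog_span (P : B -> Prop) g b : subspace P ->
  (forall w, wdeg a w = g -> P (p (twd w))) -> homog g b -> P b.
Proof.
move=> sP Pw hb; have [t pt] := nichols_surj nich b.
rewrite -hb -pt -gp.2.
apply: (@talg_homog_span (P \o p) g); [|exact: Pw|exact: homog_gpr].
split=> [|k x y Px Py] /=; first by rewrite (lin0 lp); exact: sP.1.
by rewrite lp; exact: sP.2.
Qed.

Lemma nsupp_word w : p (twd w) != 0 -> nsupp p (content w).
Proof.
move=> pw; exists (p (twd w)) => //; exists (twd w) => // v.
by rewrite mcoeffU; case: (w =P v) => [-> //|_]; rewrite eqxx.
Qed.

Lemma hone_neq0 (A : hopfAlg c) : hone (hops A) != 0.
Proof.
apply/eqP => e; have := hcounit1 (hopfP A).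
rewrite e (lin0 (hcounit_gmorph (hopfP A)).1) => /esym/eqP.
by rewrite oner_eq0.
Qed.

Lemma twd_neq0 w : twd w != 0.
Proof.
apply/eqP => /(congr1 (fun t : {malg K[word n]} => t@_w)) /eqP.
by rewrite mcoeffU eqxx mcoeff0 oner_eq0.
Qed.

Lemma talg_length_twd k w :
  talg_length k (twd w) = if size w == k then twd w else 0.
Proof. exact: lext_twd. Qed.

Lemma talg_length_linear k : linear (talg_length k : T -> T).
Proof. exact: (talg_lext_linear (a := a) (V := T)). Qed.

(** The kernel of [p] lives in lengths at least 2, so the empty word and the letters survive in [B].
    This places 0 and the basis vectors of N^n in the support. *)
Lemma nichols_word_neq0 w : (size w < 2)%N -> p (twd w) != 0.
Proof.
move=> sw; apply/eqP => pw.
have := ghi_ge2 (nichols_ker nich) (pw : [set t | p t = 0]%classic _) sw.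
by rewrite talg_length_twd eqxx; apply/eqP; exact: twd_neq0.
Qed.

Lemma nsupp_short w : (size w < 2)%N -> nsupp p (content w).
Proof. by move=> /nichols_word_neq0; exact: nsupp_word. Qed.

Lemma nsupp0 : nsupp p 0.
Proof. by rewrite -content_nil; exact: nsupp_short. Qed.

Lemma bar0 : bar a 0 = 0.
Proof. by rewrite -content_nil bar_content wdeg_nil. Qed.

Lemma bar_inj d1 d2 : nsupp p d1 -> nsupp p d2 -> bar a d1 = bar a d2 -> d1 = d2.
Proof.
move=> h1 h2 e; have := unr h1 nsupp0 h2; rewrite bar0 !addr0; exact.
Qed.

Lemma letter_degree_neq0 i : a i != 0.
Proof.
rewrite -wdeg1 -bar_content -bar0; apply/eqP => /bar_inj.
move=> /(_ (@nsupp_short [:: i] isT) nsupp0) /ffunP /(_ i).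
by rewrite !ffunE /= eqxx.
Qed.

Lemma letter_degree_inj : injective a.
Proof.
move=> i j; rewrite -!wdeg1 -!bar_content => /bar_inj.
move=> /(_ (@nsupp_short [:: i] isT) (@nsupp_short [:: j] isT)) /content_perm.
by move=> /perm_mem/(_ i); rewrite !inE eqxx => /esym/eqP.
Qed.

(** * Primitive generators of N *)

Section Comparison.
Context (N : hopfAlg c) (φ : N -> B) (ψ : B -> N).
Hypothesis gφ : gmorph φ.
Hypotheses (φK : cancel φ ψ) (ψK : cancel ψ φ).
Let lφ : linear φ := gφ.1.
Let φ0 y : φ y = 0 -> y = 0.
Proof. by move=> e; rewrite -[y]φK e -{1}(lin0 lφ) φK. Qed.

Let gψ : gmorph ψ.
Proof.
split=> [k x y|g v]; apply: (can_inj φK); rewrite ?lφ ?gφ.2 !ψK //.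
Qed.
Let lψ : linear ψ := gψ.1.

Notation one := (hone (hops N)).
Notation m := (hmul (hops N)).
Let H := hopfP N.
Let lm : linear m := (hmul_gmorph H).1.

(** Under [φ] the element lands in the span of the images of words of degree [g]; as it is nonzero,
    one of these images is nonzero. *)
Lemma degree_nsupp g (y : N) : homog g y -> y != 0 ->
  exists2 d, nsupp p d & bar a d = g.
Proof.
move=> hy y0; apply: contrapT => nd; case/negP: y0; apply/eqP/φ0.
apply: (@nichols_homog_span (fun b => b = 0) g (φ y)).
- by split=> // k u v -> ->; rewrite scaler0 addr0.
- move=> w wg; apply: contrapT => /eqP/nsupp_word sw; apply: nd.
  by exists (content w) => //; rewrite bar_content.
exact: homog_gmorph hy.
Qed.

(** By [bar_inj], a word of the same degree with nonzero image is a permutation of [w], and a word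
    with at most one letter has no permutation but itself. *)
Lemma short_component w (y : N) : (size w < 2)%N -> homog (wdeg a w) y ->
  exists k, φ y = k *: p (twd w).
Proof.
move=> sw hy; apply: (@nichols_homog_span (fun b => exists k, b = k *: p (twd w))
  (wdeg a w) (φ y)).
- split=> [|k _ _ [k1 ->] [k2 ->]]; first by exists 0; rewrite scale0r.
  by exists (k * k1 + k2); rewrite scalerDl scalerA.
- move=> v vw; have [pv|pv] := eqVneq (p (twd v)) 0.
    by exists 0; rewrite pv scale0r.
  exists 1; rewrite scale1r; suff -> : v = w by [].
  apply: perm_small_eq; first exact: sw.
  by apply/content_perm/bar_inj; [exact: nsupp_word|exact: nsupp_short|
    rewrite !bar_content].
exact: homog_gmorph hy.
Qed.

(** The map [ψ] respects degrees but not products; that these elements generate [N] follows only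
    from [talg_lift_surj]. *)
Definition nichols_generator i : N := ψ (p (twd [:: i])).
Notation x := nichols_generator.

Lemma generator_homog i : homog (a i) (x i).
Proof.
rewrite -(wdeg1 a i); apply: (homog_gmorph gψ); apply: (homog_gmorph gp).
exact: homog_twd.
Qed.

Lemma generator_neq0 i : x i != 0.
Proof.
apply/eqP => /(congr1 φ); rewrite ψK (lin0 lφ); apply/eqP.
exact: nichols_word_neq0.
Qed.

(** Since [φ] need not preserve units, both [y] and [one] are compared with the image of the empty
    word; the coefficient of [one] is nonzero. *)
Lemma degree0_component y : homog 0 y -> exists k, y = k *: one.
Proof.
move=> hy; have h0 : homog (wdeg a [::]) y by rewrite wdeg_nil.
have h1 : homog (wdeg a [::]) one by rewrite wdeg_nil; exact: hone_homog H.
have [k ek] := @short_component [::] _ isT h0.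
have [l el] := @short_component [::] _ isT h1.
have l0 : l != 0.
  by apply: contra_neq (hone_neq0 N) => l0; apply: φ0; rewrite el l0 scale0r.
exists (k / l); apply: (can_inj φK).
by rewrite (linZ _ _ lφ) el ek scalerA mulfVK.
Qed.

Lemma letter_component i y : homog (a i) y -> exists k, y = k *: x i.
Proof.
rewrite -(wdeg1 a i) => hy; have [//|k ek] := @short_component [:: i] y _ hy.
by exists k; rewrite -[y]φK ek (linZ _ _ lψ).
Qed.

Lemma generator_counit i : hcounit (hops N) (x i) = 0.
Proof.
rewrite -(generator_homog i) (hcounit_gmorph H).2 /=.
by rewrite /line_gpr (negbTE (letter_degree_neq0 i)).
Qed.

Lemma generator_primitive i : hcomul (hops N) (x i) = one ⊗ x i + x i ⊗ one.
Proof.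
pose P (t : gtens N N) := exists k l, t = k *: (one ⊗ x i) + l *: (x i ⊗ one).
have sP : subspace P.
  split=> [|k _ _ [k1 [l1 ->]] [k2 [l2 ->]]].
    by exists 0, 0; rewrite !scale0r addr0.
  exists (k * k1 + k2), (k * l1 + l2).
  by rewrite !scalerDl scalerDr !scalerA addrACA.
(* Projection to degree [a i] fixes the coproduct of [x i] and discards the homogeneous tensors of
   any other degree. *)
have [k [l e]] : P (hcomul (hops N) (x i)).
  have <- : gpr (a i) (hcomul (hops N) (x i)) = hcomul (hops N) (x i).
    exact: (homog_gmorph (hcomul_gmorph H) (generator_homog i)).
  elim/gtens_ind: (hcomul _ _) => [|s t Ps Pt|g h u v hu hv].
  - by rewrite (lin0 (gpr_linear (a i))); exact: sP.1.
  - by rewrite (linD _ _ (gpr_linear (a i))); exact: subspaceD.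
  rewrite (gpr_homog _ (homog_tprod hu hv)); case: eqP => [gh|_]; last exact: sP.1.
  have [->|u0] := eqVneq u 0; first by rewrite tprod0l; exact: sP.1.
  have [->|v0] := eqVneq v 0; first by rewrite tprod0r; exact: sP.1.
  have [d1 s1 e1] := degree_nsupp hu u0; have [d2 s2 e2] := degree_nsupp hv v0.
  have /unr : bar a d1 + bar a d2 = bar a (content [:: i]).
    by rewrite bar_content wdeg1 e1 e2.
  move=> /(_ s1 s2 (@nsupp_short [:: i] isT)) /content_letter_split.
  move=> [[d10 d2i]|[d1i d20]].
  - have [k ek] : exists k, u = k *: one.
      by apply: degree0_component; rewrite -bar0 -d10 e1.
    have [l el] : exists l, v = l *: x i.
      by apply: letter_component; rewrite -(wdeg1 a i) -bar_content -d2i e2.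
    by exists (k * l), 0; rewrite ek el tprodZl tprodZr scalerA scale0r addr0.
  - have [k ek] : exists k, v = k *: one.
      by apply: degree0_component; rewrite -bar0 -d20 e2.
    have [l el] : exists l, u = l *: x i.
      by apply: letter_component; rewrite -(wdeg1 a i) -bar_content -d1i e1.
    by exists 0, (l * k); rewrite ek el tprodZl tprodZr scalerA scale0r add0r.
(* The left counit axiom now forces [k = 1] and the right one [l = 1], because the counit kills
   [x i]. *)
have lε := (hcounit_gmorph H).1.
have bl : bilin (fun y z : N => (hcounit (hops N) y : K) *: z).
  split=> [z|y] r u v; first by rewrite lε scalerDl -scalerA.
  by rewrite scalerDr !scalerA mulrC.
have br : bilin (fun y z : N => (hcounit (hops N) z : K) *: y).
  split=> [z|y] r u v; last by rewrite lε scalerDl -scalerA.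
  by rewrite scalerDr !scalerA mulrC.
have scale_inj r : r *: x i = x i -> r = 1.
  move=> er; apply/subr0_eq/eqP; have /eqP := subrr (x i).
  rewrite -{1}er -{2}[x i]scale1r -scalerBl scaler_eq0.
  by rewrite (negbTE (generator_neq0 i)) orbF.
have := hcounitr H (x i); have := hcounitl H (x i); rewrite e.
have ll := tlift_linear bl; have lr := tlift_linear br.
rewrite (linD _ _ ll) (linD _ _ lr) !(linZ _ _ ll) !(linZ _ _ lr).
rewrite !(tlift_tprod _ _ bl) !(tlift_tprod _ _ br) generator_counit (hcounit1 H).
rewrite !scale0r !scaler0 addr0 add0r !scale1r => /scale_inj -> /scale_inj ->.
by rewrite !scale1r.
Qed.

(** * The Hopf map from the tensor algebra to N and its kernel *)

Notation f := (talg_lift (a := a) x).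
Let gf : gmorph f := talg_lift_gmorph generator_homog.
Let lf : linear f := gf.1.

(** A nonzero product has the degree of some [d] in the support. Unrolledness, applied to the first
    letter, the remaining word and [d], forces [d] to be the content of the whole word. *)
Lemma nsupp_lift_word w : lift_word x w != 0 -> nsupp p (content w).
Proof.
elim: w => [_|i w IH /= fw]; first exact: nsupp_short.
have w0 : lift_word x w != 0.
  by apply: contra_neq fw => ->; rewrite tprod0r (lin0 lm).
have hm := homog_lift_word generator_homog (i :: w).
have [d sd ed] := degree_nsupp hm fw.
have := unr (@nsupp_short [:: i] isT) (IH w0) sd.
by rewrite -content_cons => -> //; rewrite !bar_content wdeg1 -wdeg_cons.
Qed.

Lemma lift_word_degree_inj u v : lift_word x u != 0 -> lift_word x v != 0 ->
  wdeg a u = wdeg a v -> perm_eq u v.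
Proof.
move=> /nsupp_lift_word su /nsupp_lift_word sv e.
by apply: content_perm; apply: bar_inj; rewrite ?bar_content.
Qed.

(* [N] inherits the length grading: a degree of [Γ] hit by a nonzero product of
   generators determines the length of that product. *)
Lemma talg_lift_ker_length k t : f t = 0 -> f (talg_length k t) = 0.
Proof.
(* The sum of the [G g] projects [N] onto the degrees reached by nonzero products of length [k]; [f]
   intertwines it with [talg_length k]. *)
pose good g := `[< exists w, [/\ lift_word x w != 0, wdeg a w = g & size w = k] >].
pose G g (y : N) := if good g then gpr g y else 0.
have lG : linear (fun y => \sum_(g \in [set: Γ]%classic) G g y).
  apply: fsum_linear => [g r u v|g y e]; rewrite /G; case: ifP => _ //.
    exact: gpr_linear.
  by rewrite scaler0 addr0.
have lk := talg_length_linear k.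
suff E : (f \o talg_length k) =1 (fun y => \sum_(g \in [set: Γ]%classic) G g y) \o f.
  by move=> ft; have /= -> := E t; rewrite ft (lin0 lG).
apply: (talg_ext (a := a) (comp_linear lf lk) (comp_linear lG lf)) => w /=.
have hw := homog_lift_word generator_homog w.
rewrite talg_length_twd talg_lift_twd (@fsum_seq _ _ [:: wdeg a w]) // => [|g]; last first.
  by rewrite inE /G (gpr_homog _ hw) => /negbTE ->; case: ifP.
rewrite big_seq1 /G hw; have [w0|w0] := eqVneq (lift_word x w) 0.
  by rewrite w0 !if_same; case: ifP => _; rewrite ?(lin0 lf) // talg_lift_twd.
rewrite /good; case: asboolP => [[v [v0 vw vk]]|ng]; case: eqP => [wk|wk].
- exact: talg_lift_twd.
- by case: wk; rewrite -vk; apply/esym/perm_size/lift_word_degree_inj.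
- by case: ng; exists w.
- exact: lin0 lf.
Qed.

(** In length 0 the unit of [N] is nonzero. In length 1 the generators are nonzero of pairwise
    distinct degrees, hence linearly independent. *)
Lemma talg_lift_ker_ge2 k t : f t = 0 -> (k < 2)%N -> talg_length k t = 0.
Proof.
have lk := talg_length_linear.
have lc w : linear (fun t : T => (t : {malg K[word n]})@_w : K^o).
  by move=> r u v; rewrite mcoeffD mcoeffZ.
move=> /(talg_lift_ker_length k); case: k => [|[|//]] fk _.
  have E : talg_length 0 t = (t : {malg K[word n]})@_[::] *: twd [::].
    apply: (talg_ext (lk 0%N) (g := fun t : T => (t : {malg K[word n]})@_[::] *: twd [::])).
      by move=> r u v; rewrite lc scalerDl scalerA.
    by move=> [|i w]; rewrite talg_length_twd mcoeffU /= ?scale1r // scale0r.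
  move: fk; rewrite E (linZ _ _ lf) talg_lift_twd /= => /eqP.
  by rewrite scaler_eq0 (negbTE (hone_neq0 N)) orbF => /eqP ->; rewrite scale0r.
have E : talg_length 1 t = \sum_i (t : {malg K[word n]})@_[:: i] *: twd [:: i].
  apply: (talg_ext (lk 1%N)
    (g := fun t : T => \sum_i (t : {malg K[word n]})@_[:: i] *: twd [:: i])).
    move=> r u v; rewrite scaler_sumr -big_split /=; apply: eq_bigr => i _.
    by rewrite lc scalerDl scalerA.
  move=> [|j [|k w]]; rewrite talg_length_twd /=.
  - by rewrite big1 // => i _; rewrite mcoeffU scale0r.
  - rewrite (bigD1 j) //= big1 ?addr0 => [|i ij]; rewrite mcoeffU; first by rewrite eqxx scale1r.
    by rewrite eqseq_cons eq_sym (negbTE ij) scale0r.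
  - by rewrite big1 // => i _; rewrite mcoeffU eqseq_cons andbF scale0r.
rewrite E big1 // => j _; suff -> : (t : {malg K[word n]})@_[:: j] = 0 by rewrite scale0r.
have : gpr (a j) (f (talg_length 1 t)) = 0 by rewrite fk (lin0 (gpr_linear _)).
rewrite E (lin_sum _ _ _ lf) (lin_sum _ _ _ (gpr_linear _)).
rewrite (bigD1 j) //= big1 ?addr0 => [|i ij].
  rewrite (linZ _ _ lf) (linZ _ _ (gpr_linear _)) talg_lift1 (generator_homog j) => /eqP.
  by rewrite scaler_eq0 (negbTE (generator_neq0 j)) orbF => /eqP.
rewrite (linZ _ _ lf) (linZ _ _ (gpr_linear _)) talg_lift1.
rewrite (gpr_homog _ (generator_homog i)) (inj_eq letter_degree_inj) eq_sym.
by rewrite (negbTE ij) scaler0.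
Qed.

(** The coideal condition is [ker_tmap]: the coproduct of a kernel element is killed by [f ⊗ f]. The
    remaining ideal conditions follow from compatibility of [f] with the structure maps. This makes
    the maximality of the kernel of [p] applicable. *)
Lemma talg_lift_ker_ideal : graded_hopf_ideal_ge2 c [set t | f t = 0]%classic.
Proof.
have mE := talg_lift_mul generator_homog.
have cE := talg_lift_comul generator_homog generator_primitive.
have eE := talg_lift_counit generator_homog generator_counit.
have SE := talg_lift_antipode generator_homog generator_primitive generator_counit.
split; [split|exact: talg_lift_ker_length|by move=> k t; exact: talg_lift_ker_ge2].
- exact: lin0.
- by move=> k u v /= fu fv; rewrite lf fu fv scaler0 addr0.
- by move=> g u /= fu; rewrite gf.2 fu (lin0 (gpr_linear g)).
- by move=> u v /= fv; rewrite mE (tmap_tprod lf lf) fv tprod0r (lin0 lm).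
- by move=> u v /= fu; rewrite mE (tmap_tprod lf lf) fu tprod0l (lin0 lm).
- move=> u /= fu; apply: ker_tmap => //.
  by rewrite -cE fu (lin0 (hcomul_gmorph H).1).
- by move=> u /= fu; have /= <- := eE u; rewrite fu (lin0 (hcounit_gmorph H).1).
- by move=> u /= fu; have /= <- := SE u; rewrite fu (lin0 (hantipode_gmorph H).1).
Qed.

Lemma talg_lift_ker_sub t : f t = 0 -> p t = 0.
Proof. exact: (nichols_max nich talg_lift_ker_ideal). Qed.

(** A word of degree [g] that survives under [f] or [p] has its content in the support, and
    [bar_inj] leaves one such content. So the surviving words are permutations of a single word. *)
Lemma finite_words g : exists2 s : seq (word n),
  (forall w, w \in s -> wdeg a w = g) &
  forall w, wdeg a w = g -> w \notin s -> f (twd w) = 0 /\ p (twd w) = 0.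
Proof.
pose good w := wdeg a w = g /\ nsupp p (content w).
have [[w0 [w0g s0]]|ng] := pselect (exists w, good w).
  exists (permutations w0) => w; first by rewrite mem_permutations => /(wdeg_perm a) ->.
  move=> wg; rewrite mem_permutations => nw.
  have nsw : ~ nsupp p (content w).
    move=> sw; case/negP: nw; apply: content_perm; apply: bar_inj => //.
    by rewrite !bar_content wg w0g.
  split; apply: contrapT => /eqP w0'; apply: nsw.
    by apply: nsupp_lift_word; rewrite -(talg_lift_twd a).
  exact: nsupp_word.
exists [::] => // w wg _; split; apply: contrapT => /eqP w0; apply: ng; exists w; split=> //.
  by apply: nsupp_lift_word; rewrite -(talg_lift_twd a).
exact: nsupp_word.
Qed.

(** Row vectors serve as coordinates on the span of the finitely many relevant words, and
    [finite_dim_comparison] is applied to [p] and to [φ] after [f]. The image condition holds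
    because [p] is onto in each degree, the kernel condition by [talg_lift_ker_sub]. *)
Lemma talg_lift_component g :
  (forall y, homog g y -> exists t, y = f t) /\
  (forall t, homog g t -> p t = 0 -> f t = 0).
Proof.
have [s sg sP] := finite_words g.
pose e (v : 'rV[K]_(size s)) : T := \sum_(j < size s) v 0 j *: twd (nth [::] s j).
have le : linear e.
  move=> k u v; rewrite /e scaler_sumr -big_split /=; apply: eq_bigr => j _.
  by rewrite !mxE scalerDl scalerA.
have eE w : w \in s -> exists v, e v = twd w.
  rewrite -index_mem => ws; exists (delta_mx 0 (Ordinal ws)).
  rewrite /e (bigD1 (Ordinal ws)) //= big1 ?addr0 => [|j jw]; rewrite mxE eqxx /=.
    by rewrite eqxx scale1r nth_index // -index_mem.
  by rewrite (negbTE jw) scale0r.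
have he v : homog g (e v).
  have sH := @homog_subspace _ _ T g.
  rewrite /e; apply: (subspace_sum _ sH) => j; apply: (subspaceZ _ sH).
  by rewrite -(sg (nth [::] s j)) ?mem_nth //; exact: homog_twd.
have te t : homog g t -> exists v, f t = f (e v) /\ p t = p (e v).
  apply: (@talg_homog_span (fun t => exists v, f t = f (e v) /\ p t = p (e v))).
    split=> [|k u v [u' [fu pu]] [v' [fv pv]]]; first by exists 0; rewrite (lin0 le).
    by exists (k *: u' + v'); rewrite le lf !lp lf fu pu fv pv.
  move=> w wg; have [/eE[v <-]|ws] := boolP (w \in s); first by exists v.
  by exists 0; have [-> ->] := sP w wg ws; rewrite (lin0 le) (lin0 lf) (lin0 lp).
have pe b : homog g b -> exists v, b = p (e v).
  move=> hb; have [t pt] := nichols_surj nich b.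
  have [v [_ pv]] := te _ (homog_gpr g t).
  by exists v; rewrite -pv gp.2 pt.
have lb := comp_linear lp le; have lh := comp_linear lφ (comp_linear lf le).
have [imh kerh] := finite_dim_comparison lb lh
  (fun v => pe _ (homog_gmorph gφ (homog_gmorph gf (he v))))
  (fun v h => talg_lift_ker_sub (φ0 h)).
split=> [y hy|t ht pt].
  have [v yv] := pe _ (homog_gmorph gφ hy); have [u /= vu] := imh v.
  by exists (e u); apply: (can_inj φK); rewrite yv vu.
by have [v [-> pv]] := te t ht; apply: φ0; apply: kerh; rewrite /= -pv.
Qed.

Lemma talg_lift_surj y : exists t, y = f t.
Proof.
have [s _ ->] := gpr_sum y; apply: (subspace_sum _ (im_subspace lf)) => g.
exact: (talg_lift_component g).1 _ (homog_gpr g y).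
Qed.

Lemma talg_lift_ker t : f t = 0 <-> p t = 0.
Proof.
split; first exact: talg_lift_ker_sub.
move=> pt; have [s _ ->] := gpr_sum t; apply: (subspace_sum _ (ker_subspace lf)) => g.
apply: (talg_lift_component g).2; first exact: homog_gpr.
by rewrite gp.2 pt (lin0 (gpr_linear g)).
Qed.

(** The map [F] is [f] factored through [p], computed on chosen preimages; equality of the two
    kernels makes it independent of the choice and injective. Each Hopf identity is checked on
    preimages in the tensor algebra. *)
Lemma nichols_comparison : exists F : B -> N, hopf_iso F.
Proof.
pose q b := projT1 (cid (nichols_surj nich b)).
have pq b : p (q b) = b by rewrite /q; case: cid.
pose F b := f (q b).
have Fp t : F (p t) = f t.
  by apply/subr0_eq; rewrite -(linB _ _ lf); apply/talg_lift_ker; rewrite (linB _ _ lp) pq subrr.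
have lF : linear F by move=> k u v; rewrite -[u]pq -[v]pq -lp !Fp lf.
have FpE : F \o p = f by apply/funext => t; exact: Fp.
have P := nichols_morph nich.
exists F; split; last first.
  have inj : injective F.
    move=> u v; rewrite -[u]pq -[v]pq !Fp => fuv; apply/subr0_eq.
    by rewrite -(linB _ _ lp); apply/talg_lift_ker; rewrite (linB _ _ lf) fuv subrr.
  pose G y := p (projT1 (cid (talg_lift_surj y))).
  have FG : cancel G F by move=> y; rewrite /G; case: cid => t /= ->; exact: Fp.
  by exists G => // b; apply: inj; rewrite FG.
split.
- by split=> // g b; rewrite -[b]pq -gp.2 !Fp gf.2.
- have lFF := tmap_linear lF lF; have lmB := (hmul_gmorph (hopfP B)).1.
  elim/tens_ind => [|s t es et|u v].
  + by rewrite (lin0 lmB) (lin0 lF) (lin0 lFF) (lin0 lm).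
  + by rewrite (linD _ _ lmB) (linD _ _ lF) (linD _ _ lFF) (linD _ _ lm) es et.
  rewrite (tmap_tprod lF lF) -[u]pq -[v]pq !Fp -(tmap_tprod lp lp) -(hm_mul P) Fp.
  by rewrite (talg_lift_mul generator_homog) (tmap_tprod lf lf).
- by rewrite -(hm_one P) Fp talg_lift_twd.
- move=> b; rewrite -[b]pq Fp (talg_lift_comul generator_homog generator_primitive).
  by rewrite (hm_comul P) (tmap_comp _ lp lp lF lF) FpE.
- by move=> b; rewrite -[b]pq Fp (talg_lift_counit generator_homog generator_counit) (hm_counit P).
- move=> b; rewrite -[b]pq (hm_antipode P) !Fp.
  exact: talg_lift_antipode generator_homog generator_primitive generator_counit _.
Qed.

End Comparison.
End Nichols.

Theorem lemma5p6 (R : realType) (Γ : zmodType) (Q : Γ -> R[i])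
    (c : abelian3cocycle R[i] Γ) (n : nat) (a : 'I_n -> Γ)
    (B : hopfAlg c) (p : talg R[i] a -> B) (N : hopfAlg c) :
  quadratic_form Q ->
  (forall x, sigma c x x = Q x) ->
  is_nichols p ->
  gisomorphic N B ->
  sufficiently_unrolled p ->
  exists f : B -> N, hopf_iso f.
Proof.
move=> _ _ nich [φ [gφ [ψ φK ψK]]] unr.
exact (nichols_comparison nich unr gφ φK ψK).
Qed.
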